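(* Let $m$ be an odd positive integer and let $\{a_1,a_2,\dots,a_m\}$ be a multiset of $m$ elements of the cyclic group $\mathbb{Z}_m=\mathbb{Z}/m\mathbb{Z}$. Then, after a suitable permutation of the indices, either $\sum_{i=1}^m i a_i = 0$ in $\mathbb{Z}_m$, or $a_1=a_2=\cdots=a_{m-2}=a$, $a_{m-1}=a+b$, $a_m=a-b$ for some elements $a,b\in\mathbb{Z}_m$ with $\gcd(b,m)=1$. *)

(* Defs.v *)
From HB Require Import structures.
From mathcomp Require Import all_boot all_order all_algebra all_fingroup.

Set Implicit Arguments.
Unset Strict Implicit.
Unset Printing Implicit Defensive.

(* Z/mZ for m > 0, with its additive group structure from zmodp.  Unlike 'Z_m,
   which is Z/2Z when m = 1, this is the trivial group when m = 1. *)
Notation Zmod m := ('I_(m.-1.+1)) (only parsing).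

(* Main.v *)
Require Import Defs.
From HB Require Import structures.
From mathcomp Require Import all_boot all_order all_algebra all_fingroup.
From mathcomp Require Import ring zify.

Set Implicit Arguments.
Unset Strict Implicit.
Unset Printing Implicit Defensive.

Import Order.TTheory GRing.Theory Num.Theory.
Local Open Scope ring_scope.


(** Encode an arrangement of a set A of m elements as a weight function on A that
is injective modulo m. For m prime, a sum s of the elements that is nonzero
modulo m can be corrected by shifting all weights. Otherwise there are three
distinct values unless all are equal; three distinct elements in three
consecutive positions produce at least 4 sums, the remaining m - 3 elements at
least m - 3 sums unless they are all equal, and Cauchy-Davenport yields every
residue.

For m = p n with p prime, cut A into p rows of n elements and choose, by
induction on m, weights modulo n in each row so that the total vanishes modulo n.
Elements with the same weight modulo n form n columns of p elements, in which the
weights w + n d, with d running over the residues modulo p, can still be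
permuted. The values reached by a column that is not constant modulo p contain
all nonzero residues, as they are stable under multiplication by units, so two
such columns suffice to kill the total modulo p n. They exist as soon as the
numbers of elements of some residue class modulo p in two rows differ by at
least 2, and exchanging elements between rows produces such rows except when all
but two elements agree modulo n and modulo p. *)

(** * Sums in a prime field *)

Section CauchyDavenport.
Variable p : nat.
Hypothesis p_pr : prime p.
Local Notation F := 'F_p.

Lemma mulrn_Fp_inj (c : F) (i j : nat) :
  c != 0 -> c *+ i = c *+ j -> i = j %[mod p].
Proof.
move=> c0; rewrite -!(mulr_natr c) => /(mulfI c0) /(congr1 val).
by rewrite /= !val_Fp_nat.
Qed.

Lemma Fp_multiple (c x : F) : c != 0 -> exists2 e : nat, (e < p)%N & x = c *+ e.
Proof.
move=> c0; exists (x / c : F); first by rewrite -[ltnRHS](Fp_cast p_pr) ltn_ord.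
by rewrite -mulr_natr natr_Zp mulrC divfK.
Qed.

(** A set stable under adding [d] contains [a + d *+ e] for every [e], hence all of [F], since a
    nonzero [d] generates it. *)
Lemma proper_shift (A : {set F}) (d : F) :
  d != 0 -> A != set0 -> A != setT -> exists2 a, a \in A & a + d \notin A.
Proof.
move=> d0 /set0Pn[a aA] AT.
case: (pickP [pred a | (a \in A) && (a + d \notin A)]) => [b /andP[]|clA].
  by exists b.
case/negP: AT; apply/eqP/setP => x; rewrite inE.
have [e _ xe] := Fp_multiple (x - a) d0.
rewrite -(subrK a x) xe addrC {xe}.
elim: e => [|e IHe]; first by rewrite addr0.
by have := clA (a + d *+ e); rewrite /= IHe /= -addrA -mulrSr => /negbFE.
Qed.

(** Induction on [#|B|] with a Dyson transform, which preserves [#|A| + #|B|], does not enlarge the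
    sumset and shrinks [B]. *)
Theorem Cauchy_Davenport (A B : {set F}) :
    A != set0 -> B != set0 ->
  (minn p (#|A| + #|B|).-1 <= #|[set (a + b)%R | a in A, b in B]|)%N.
Proof.
have [n] := ubnP #|B|; elim: n A B => // n IHn A B leBn A0 B0.
have [B1|B1] := leqP #|B| 1.
  have /cards1P[b ->] : #|B| == 1%N by rewrite eqn_leq B1 card_gt0.
  rewrite cards1 addn1 /= (leq_trans (geq_minr _ _)) //.
  rewrite -(card_imset A (addIr b)) subset_leq_card //.
  by apply/subsetP => _ /imsetP[a aA ->]; apply/imset2P; exists a b; rewrite ?inE.
have [AT|AT] := eqVneq A setT.
  rewrite (leq_trans (geq_minl _ _)) // -[leqLHS]card_Fp // -cardsT.
  case/set0Pn: B0 => b bB; rewrite subset_leq_card //.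
  apply/subsetP => x _; apply/imset2P; exists (x - b) b; rewrite ?AT ?inE //.
  by rewrite subrK.
have /card_gt1P[b [b' [bB b'B bb']]] := B1.
have db : b' - b != 0 by rewrite subr_eq0 eq_sym.
have [a aA adA] := proper_shift db A0 AT.
(* This [e] keeps [b] in [B'], as [b + e = a], and throws out [b'], as [b' + e = a + (b' - b)] lies
   outside [A]. *)
pose e := a - b.
pose A' := A :|: [set x + e | x in B].
pose B' := [set x in B | x + e \in A].
have B'0 : B' != set0.
  by apply/set0Pn; exists b; rewrite inE bB /e addrC subrK.
have B'B : (#|B'| < #|B|)%N.
  apply: proper_card; apply/properP; split; first by apply/subsetP => x /setIdP[].
  exists b' => //; rewrite inE b'B /= /e.
  by rewrite (_ : b' + (a - b) = a + (b' - b)) //; ring.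
have A'0 : A' != set0 by case/set0Pn: A0 => x xA; apply/set0Pn; exists x; rewrite inE xA.
have cardAB : (#|A'| + #|B'| = #|A| + #|B|)%N.
  have <- : #|A :&: [set x + e | x in B]| = #|B'|.
    rewrite -(card_imset B' (addIr e)); apply: eq_card => x; rewrite inE.
    apply/andP/imsetP => [[xA /imsetP[y yB xy]]|[y /setIdP[yB yA] ->]].
      by exists y => //; rewrite inE yB -xy.
    by split=> //; apply: imset_f.
  by rewrite cardsUI (card_imset B (addIr e)).
rewrite -cardAB; apply: leq_trans (IHn A' B' _ A'0 B'0) _; first exact: leq_trans B'B _.
apply: subset_leq_card; apply/subsetP => _ /imset2P[x y xA' /setIdP[yB yA] ->].
case/setUP: xA' => [xA|/imsetP[z zB ->]]; apply/imset2P; first by exists x y.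
by exists (y + e) z => //; ring.
Qed.

End CauchyDavenport.

(** The sum of the entries weighted by position, counted from 0: prepending an entry moves the rest
    one place, which adds their plain sum. *)
Fixpoint dot (V : comPzRingType) (s : seq V) : V :=
  if s is _ :: s' then dot s' + \sum_(x <- s') x else 0.

Section Dot.
Variable V : comPzRingType.
Implicit Types s t : seq V.

Lemma dot_cat s t : dot (s ++ t) = dot s + dot t + (\sum_(x <- t) x) *+ size s.
Proof.
elim: s => [|x s IHs] /=; first by rewrite mulr0n addr0 add0r.
by rewrite IHs big_cat /= mulrSr; ring.
Qed.

Lemma dotE s : dot s = \sum_(i < size s) s`_i *+ i.
Proof.
elim: s => [|x s IHs] /=; first by rewrite big_ord0.
rewrite big_ord_recl /= mulr0n add0r IHs (big_nth 0) big_mkord -big_split /=.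
by apply: eq_bigr => i _; rewrite /bump /= add1n mulrSr.
Qed.

Lemma dot_nseq0 k : dot (nseq k (0 : V)) = 0.
Proof.
by elim: k => //= k ->; rewrite add0r big_nseq; elim: k => //= k ->; rewrite add0r.
Qed.

Lemma sum_nseq k (x : V) : \sum_(y <- nseq k x) y = x *+ k.
Proof. by rewrite big_nseq iter_addr addr0. Qed.

Lemma dot_translate s (x : V) :
  dot [seq y + x | y <- s] = dot s + dot (nseq (size s) x).
Proof.
elim: s => [|y s IHs] /=; first by rewrite addr0.
rewrite IHs big_map big_split /= sum_nseq -!addrA; congr (_ + _).
by rewrite big_const_seq count_predT iter_addr addr0 addrCA.
Qed.

(** Moving [y] right past [k] copies of [x] raises its position by [k] and lowers each of theirs by
    one. *)
Lemma dot_slide (P Q : seq V) (x y : V) k :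
  dot (P ++ (nseq k x ++ [:: y]) ++ Q) =
  dot (P ++ (y :: nseq k x) ++ Q) + (y - x) *+ k.
Proof.
rewrite !dot_cat !big_cat /= ?big_cons ?big_nil !size_cat !size_nseq /= ?big_cons ?big_nil !sum_nseq.
by ring.
Qed.

End Dot.


(** * Values of the weighted sum over all arrangements *)

Section Reach.
Variable p : nat.
Hypothesis p_pr : prime p.
Local Notation F := 'F_p.
Implicit Types s t : seq F.

Definition reach s : {set F} := [set x in map (@dot F) (permutations s)].

Lemma reachP s x : reflect (exists2 t, perm_eq t s & dot t = x) (x \in reach s).
Proof.
rewrite inE; apply: (iffP mapP) => [[t]|[t ts <-]].
  by rewrite mem_permutations => ts ->; exists t.
by exists t; rewrite ?mem_permutations.
Qed.

Lemma reach_perm s t : perm_eq s t -> reach s = reach t.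
Proof.
move=> st; apply/setP => x.
by apply/reachP/reachP => -[r rs <-]; exists r; rewrite // ?(permPr st) // -(permPr st).
Qed.

Lemma reach_neq0 s : reach s != set0.
Proof. by apply/set0Pn; exists (dot s); apply/reachP; exists s. Qed.

(** Joining arrangements of [s] and [t] adds their values, up to a shift that depends only on the
    size of [s] and the sum of [t]. *)
Lemma reach_cat s t : (minn p (#|reach s| + #|reach t|).-1 <= #|reach (s ++ t)|)%N.
Proof.
apply: leq_trans (Cauchy_Davenport p_pr (reach_neq0 s) (reach_neq0 t)) _.
rewrite -(card_imset (reach (s ++ t)) (addIr (- ((\sum_(x <- t) x) *+ size s)))).
apply/subset_leq_card/subsetP => _ /imset2P[_ _ /reachP[s' ss' <-] /reachP[t' tt' <-] ->].
apply/imsetP; exists (dot (s' ++ t')); first by apply/reachP; exists (s' ++ t'); rewrite ?perm_cat.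
by rewrite dot_cat (perm_size ss') (perm_big _ tt')  /= addrK.
Qed.

Lemma reach_translate s (x : F) : #|reach [seq y + x | y <- s]| = #|reach s|.
Proof.
rewrite -(card_imset (reach s) (addIr (dot (nseq (size s) x)))); apply: eq_card => z.
apply/reachP/imsetP => [[t ts <-]|[_ /reachP[t ts <-] ->]].
  exists (dot [seq y - x | y <- t]).
    apply/reachP; exists [seq y - x | y <- t] => //.
    by rewrite -[s](mapK (addrK x)) perm_map.
  have -> : size s = size [seq y - x | y <- t] by rewrite size_map (perm_size ts) size_map.
  by rewrite -dot_translate (mapK (subrK x)).
exists [seq y + x | y <- t]; first exact: perm_map.
by rewrite dot_translate (perm_size ts).
Qed.

Lemma card_reach_gt0 s : (0 < #|reach s|)%N.
Proof. by rewrite card_gt0 reach_neq0. Qed.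

Lemma uniq_card_ge (A : {set F}) (r : seq F) :
  uniq r -> {subset r <= A} -> (size r <= #|A|)%N.
Proof.
by move=> ur rA; rewrite -(card_uniqP ur); apply/subset_leq_card/subsetP.
Qed.

Lemma uniq_mulrn (c : F) (r : seq nat) :
  c != 0 -> uniq (map (modn^~ p) r) -> uniq (map (fun k => c *+ k) r).
Proof.
move=> c0; elim: r => //= k r IHr /andP[kr /IHr ->]; rewrite andbT.
apply: contra kr => /mapP[l lr /(mulrn_Fp_inj p_pr c0) kl].
by apply/mapP; exists l.
Qed.

Lemma reach_distinct3 (x y z : F) :
  (3 < p)%N -> uniq [:: x; y; z] -> (4 <= #|reach [:: x; y; z]|)%N.
Proof.
move=> p3; rewrite /= !inE !negb_or andbT => /andP[/andP[xy xz] yz].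
have two0 : (2 : F) != 0.
  by rewrite -(dvdn_pcharf (pchar_Fp p_pr)); apply/negP => /dvdn_leq; lia.
have three0 : (3 : F) != 0.
  by rewrite -(dvdn_pcharf (pchar_Fp p_pr)); apply/negP => /dvdn_leq; lia.
have mem t : perm_eq t [:: x; y; z] -> dot t \in reach [:: x; y; z].
  by move=> tP; apply/reachP; exists t.
have dot3 (a b c : F) : dot [:: a; b; c] = b + 2 * c.
  by rewrite /= !big_cons big_nil; ring.
have neq (a b c : F) : c != 0 -> a - b = c -> a != b.
  by move=> c0 abc; rewrite -subr_eq0 abc.
have xy0 : x - y != 0 by rewrite subr_eq0.
have xz0 : x - z != 0 by rewrite subr_eq0.
have yz0 : y - z != 0 by rewrite subr_eq0.
have P1 : perm_eq [:: x; z; y] [:: x; y; z].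
  by apply/seq.permP => q /=; ring.
have P2 : perm_eq [:: y; x; z] [:: x; y; z] by apply/seq.permP => q /=; ring.
have P3 : perm_eq [:: z; x; y] [:: x; y; z] by apply/seq.permP => q /=; ring.
have P4 : perm_eq [:: y; z; x] [:: x; y; z] by apply/seq.permP => q /=; ring.
have P5 : perm_eq [:: z; y; x] [:: x; y; z] by apply/seq.permP => q /=; ring.
(* If [x] is the midpoint of [y] and [z], four values are [3 x] plus or minus [d] and [2 d], with
   [d = x - y]. Otherwise four values differ by [y - z], [2 (x - y)], [2 (x - z)] or [y + z - 2 x]
   up to sign. *)
have [e|ne] := eqVneq (y + z) (2 * x).
  have zE : z = 2 * x - y by rewrite -e; ring.
  apply: (@uniq_card_ge _ [:: dot [:: y; z; x]; dot [:: z; y; x];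
      dot [:: y; x; z]; dot [:: z; x; y]]); last first.
    by apply/allP; rewrite -[all _ _]/([&& _ \in _, _ \in _, _ \in _, _ \in _ & true]) !mem.
  have xy2 : 2 * (x - y) != 0 by rewrite mulf_neq0.
  have xy3 : 3 * (x - y) != 0 by rewrite mulf_neq0.
  have xy4 : 2 * (2 * (x - y)) != 0 by rewrite !mulf_neq0.
  rewrite !dot3 zE /= !inE !negb_or !andbT -!andbA; apply/and5P; split; last (apply/andP; split).
  - by apply: neq xy2 _; ring.
  - by rewrite eq_sym; apply: neq xy0 _; ring.
  - by apply: neq xy3 _; ring.
  - by rewrite eq_sym; apply: neq xy3 _; ring.
  - by apply: neq xy0 _; ring.
  - by apply: neq xy4 _; ring.
have ne0 : y + z - 2 * x != 0 by rewrite subr_eq0.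
apply: (@uniq_card_ge _ [:: dot [:: x; y; z]; dot [:: x; z; y];
    dot [:: y; z; x]; dot [:: z; y; x]]); last first.
  by apply/allP; rewrite -[all _ _]/([&& _ \in _, _ \in _, _ \in _, _ \in _ & true]) !mem.
rewrite !dot3 /= !inE !negb_or !andbT -!andbA; apply/and5P; split; last (apply/andP; split).
- by rewrite eq_sym; apply: neq yz0 _; ring.
- by apply: neq ne0 _; ring.
- by rewrite eq_sym; apply: (neq _ _ _ (mulf_neq0 two0 xz0)); ring.
- by rewrite eq_sym; apply: (neq _ _ _ (mulf_neq0 two0 xy0)); ring.
- by apply: (neq _ _ _ ne0); ring.
- by rewrite eq_sym; apply: neq yz0 _; ring.
Qed.

End Reach.


(** * Sequences with two values or two exceptional entries *)

Section Growth.
Variable p : nat.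
Hypothesis p_pr : prime p.
Local Notation F := 'F_p.
Implicit Types s t : seq F.

Lemma reach_two_values (x y : F) a b :
    x != y -> (0 < a)%N -> (0 < b)%N -> (a + b <= p)%N ->
  (a + b <= #|reach (nseq a x ++ nseq b y)|)%N.
Proof.
move=> xy; case: a => // a _; case: b => // b _ ab.
have yx0 : y - x != 0 by rewrite subr_eq0 eq_sym.
have nseqSr c (z : F) : nseq c.+1 z = nseq c z ++ [:: z] by elim: c => //= c ->.
(* Starting from y ... y x ... x, slide the last y to the right end, then the
   first x to the left end: each step adds y - x. *)
pose v0 := dot (nseq b.+1 y ++ nseq a.+1 x).
pose r := [seq v0 + d | d <- [seq (y - x) *+ k | k <- iota 0 (a.+1 + b.+1)]].
rewrite -[leqLHS](_ : size r = _); last by rewrite !size_map size_iota.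
apply: uniq_card_ge.
  rewrite map_inj_uniq; last exact: addrI.
  apply: (uniq_mulrn p_pr yx0).
  rewrite (_ : map _ _ = iota 0 (a.+1 + b.+1)) ?iota_uniq //.
  rewrite -[RHS]map_id; apply/eq_in_map => k.
  by rewrite mem_iota => /andP[_ kab]; rewrite modn_small // (leq_trans kab).
move=> _ /mapP[_ /mapP[k + ->] ->]; rewrite mem_iota add0n => kab.
apply/reachP; have [ka|ak] := leqP k a.+1.
  exists (nseq b y ++ (nseq k x ++ [:: y]) ++ nseq (a.+1 - k) x).
    apply/seq.permP => q; rewrite !count_cat !count_nseq /=; lia.
  by rewrite dot_slide /v0 (nseqSr b) -catA /= -nseqD subnKC.
pose l := (k - a.+1)%N; have kE : k = (a.+1 + l)%N by rewrite subnKC // ltnW.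
have lb : (l <= b)%N by lia.
exists (nseq (b - l) y ++ (x :: nseq l y) ++ (nseq a x ++ [:: y])).
  apply/seq.permP => q; rewrite !count_cat !count_nseq /= count_nseq; lia.
have := dot_slide (nseq (b - l) y) (nseq a x ++ [:: y]) y x l.
rewrite -opprB mulNrn => /eqP; rewrite eq_sym subr_eq => /eqP ->.
rewrite kE mulrnDr addrA; congr (_ + _).
have -> : nseq (b - l) y ++ (nseq l y ++ [:: x]) ++ nseq a x ++ [:: y] =
   nseq b y ++ (nseq a.+1 x ++ [:: y]) ++ [::].
  by rewrite cats0 !catA -nseqD subnK // -!catA.
by rewrite dot_slide cats0 /v0 (nseqSr b) -catA.
Qed.

Lemma dot_sparse (b c : F) i j l :
  dot (nseq i 0 ++ b :: nseq j 0 ++ c :: nseq l 0) = b *+ i + c *+ (i + j.+1).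
Proof.
rewrite -cat1s !dot_cat -cat1s !dot_cat !big_cat /= !big_seq1 !sum_nseq !dot_nseq0.
rewrite ?big_nil ?size_nseq ?size_cat /=. rewrite !big_cons sum_nseq; ring.
Qed.

Lemma reach_two_exceptions0 (b c : F) k :
    b != 0 -> c != 0 -> b != c -> (1 < k)%N -> (k.+2 < p)%N ->
  (k.+2 <= #|reach (nseq k (0%R : F) ++ [:: b; c])|)%N.
Proof.
move=> b0 c0 bc k1 kp.
set s := nseq k 0 ++ _.
(* Writing [b] as [c *+ e] with [1 < e < p] makes every value a multiple of [c], so that values are
   compared through integers modulo [p]. *)
have [e ep bE] := Fp_multiple p_pr b c0.
have e0 : e != 0%N by apply: contra_neq b0 => e0; rewrite bE e0.
have e1 : e != 1%N by apply: contra_neq bc => e1; rewrite bE e1.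
have memP i j l : (i + j + l = k)%N -> c *+ (e * i + (i + j.+1)) \in reach s.
  move=> ijl; apply/reachP; exists (nseq i 0 ++ b :: nseq j 0 ++ c :: nseq l (0%R : F)).
    by apply/seq.permP => q; rewrite !(count_cat, count_nseq) /= !(count_cat, count_nseq) /= count_nseq -ijl; ring.
  by rewrite dot_sparse bE [RHS]mulrnDr (mulrnA c e).
have memb : c *+ e \in reach s.
  apply/reachP; exists (nseq 0 0 ++ c :: nseq 0 0 ++ b :: nseq k (0%R : F)).
    by apply/seq.permP => q; rewrite !(count_cat, count_nseq) /= !(count_cat, count_nseq) /=; ring.
  by rewrite dot_sparse mulr0n add0r mulr1n.
(* With b at position 0, the values c, 2c, ..., (k+1)c are reached; moving b to
   position 1, or c to position 0, gives a multiple of c outside that range. *)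
have [E EP Es] : exists2 E, (E %% p)%N \notin iota 1 k.+1 & c *+ E \in reach s.
  have [ek|ke] := leqP k.+2 e.
    by exists e => //; rewrite mem_iota modn_small //; lia.
  have [ek|ek] := eqVneq e k.+1.
    exists k.+3; last by have := memP 1%N 0%N k.-1; rewrite ek muln1 !addnS !addn0; apply; lia.
    have [kp'|kp'] := eqVneq k.+3 p; first by rewrite kp' modnn mem_iota.
    by rewrite mem_iota modn_small; lia.
  exists k.+2; first by rewrite mem_iota modn_small //; lia.
  have := memP 1%N (k - e)%N e.-1; rewrite (_ : e * 1 + (1 + (k - e).+1) = k.+2)%N; last by lia.
  by apply; lia.
pose r := [seq c *+ j | j <- E :: iota 1 k.+1].
rewrite -[leqLHS](_ : size r = _); last by rewrite !size_map /= size_iota.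
have small : map (modn^~ p) (iota 1 k.+1) = iota 1 k.+1.
  rewrite -[RHS]map_id; apply/eq_in_map => j; rewrite mem_iota => jk.
  by rewrite modn_small //; lia.
apply: uniq_card_ge.
  by apply: (uniq_mulrn p_pr c0); rewrite map_cons small cons_uniq EP iota_uniq.
move=> _ /mapP[j + ->]; rewrite inE => /predU1P[-> //|].
rewrite mem_iota => jk.
have := memP 0%N j.-1 (k - j.-1)%N; rewrite muln0 !add0n prednK; last by lia.
by apply; lia.
Qed.

End Growth.


(** * Sequences by number of distinct values *)

Section SeqShape.
Variable T : eqType.
Implicit Types s r : seq T.

Lemma perm_three_values s x y z :
  uniq [:: x; y; z] -> x \in s -> y \in s -> z \in s ->
  exists r, perm_eq s [:: x, y, z & r].
Proof.
rewrite /= !inE !negb_or andbT => /andP[/andP[xy xz] yz] xs ys zs.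
have sx := perm_to_rem xs; move: (ys); rewrite (perm_mem sx) inE eq_sym (negPf xy) /= => yr.
have sy := perm_to_rem yr; move: (zs).
rewrite (perm_mem sx) inE eq_sym (negPf xz) /= (perm_mem sy) inE eq_sym (negPf yz) /= => zr.
exists (rem z (rem y (rem x s))); rewrite (permPl sx) perm_cons (permPl sy) perm_cons.
exact: perm_to_rem.
Qed.

Lemma seq_shape s :
  [\/ constant s,
      exists x y a b, [/\ x != y, (0 < a)%N, (0 < b)%N & perm_eq s (nseq a x ++ nseq b y)]
    | exists x y z r, uniq [:: x; y; z] /\ perm_eq s [:: x, y, z & r]].
Proof.
case: s => [|x s]; first exact: Or31.
have [cs|] := boolP (all (pred1 x) s); first exact: Or31.
case/allPn=> y ys /= yx.
have [xys|] := boolP (all (pred2 x y) s); last first.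
  case/allPn=> z zs; rewrite /= negb_or => /andP[zx zy]; apply: Or33.
  exists x, y, z; have u3 : uniq [:: x; y; z].
    by rewrite /= !inE !negb_or ![x == _]eq_sym yx zx eq_sym zy.
  have [r sr] := @perm_three_values (x :: s) x y z u3 (mem_head _ _)
    (mem_behead (ys : y \in behead (x :: s))) (mem_behead (zs : z \in behead (x :: s))).
  by exists r.
apply: Or32; exists x, y, (count_mem x (x :: s)), (count_mem y (x :: s)).
split; rewrite 1?eq_sym //.
- by rewrite /= eqxx.
- by rewrite -has_count has_pred1 inE ys orbT.
apply/allP => z; rewrite !mem_cat !mem_nseq => zs; apply/eqP.
have zxy : (z == x) || (z == y).
  case/or3P: zs => [|/andP[_ ->]|/andP[_ ->]]; rewrite ?orbT //.
  rewrite inE => /predU1P[->|/(allP xys)]; first by rewrite eqxx.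
  by [].
rewrite count_cat !count_nseq /=.
case/orP: zxy => /eqP->; rewrite ?eqxx ?(negPf yx) ?mul0n ?mul1n ?addn0 //.
by rewrite eq_sym (negPf yx).
Qed.

(** For the induction on length, a remainder longer than 1 must not be constant. If it is constant
    [c], exchanging [c] with [x] mends this, unless [c] is one of [x], [y], [z]; then only two
    entries differ from [c]. *)
Lemma three_values_shape s x y z r :
    uniq [:: x; y; z] -> perm_eq s [:: x, y, z & r] ->
  (exists x' y' z' r', [/\ uniq [:: x'; y'; z'], perm_eq s [:: x', y', z' & r']
                         & (size r' <= 1)%N || ~~ constant r'])
  \/ (exists c y' z' k, [/\ y' != c, z' != c, y' != z', (1 < k)%N
                         & perm_eq s (nseq k c ++ [:: y'; z'])]).
Proof.
move=> u3 sE; have [ok|] := boolP ((size r <= 1)%N || ~~ constant r).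
  by left; exists x, y, z, r.
rewrite negb_or -ltnNge negbK => /andP[r1 /(constantP x)[c rc]].
move: u3; rewrite /= !inE !negb_or andbT => /andP[/andP[xy xz] yz].
move: sE r1; rewrite rc size_nseq; set k := size r => sE k1.
have [yx zx zy] : [/\ y != x, z != x & z != y] by split; rewrite eq_sym.
have k1' : (1 < k.+1)%N by exact: leqW.
have [cx|cx] := eqVneq c x.
  right; exists c, y, z, k.+1; rewrite cx; split=> //.
  by apply/seq.permP => q; rewrite (seq.permP sE) cx /= !count_cat /=; ring.
have [cy|cy] := eqVneq c y.
  right; exists c, x, z, k.+1; rewrite cy; split=> //.
  by apply/seq.permP => q; rewrite (seq.permP sE) cy /= !count_cat /=; ring.
have [cz|cz] := eqVneq c z.
  right; exists c, x, y, k.+1; rewrite cz; split => //.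
  by apply/seq.permP => q; rewrite (seq.permP sE) cz /= !count_cat /=; ring.
left; exists c, y, z, (x :: nseq k.-1 c); split.
- by rewrite /= !inE !negb_or cy cz yz.
- apply/seq.permP => q; rewrite (seq.permP sE) /=.
  by rewrite -[k in LHS](prednK (ltnW k1)) /=; ring.
- by case: k k1 {rc sE k1'} => [|[|k]] //= _; rewrite (negPf cx) ?orbT.
Qed.

End SeqShape.

(** * The theorem for sequences over a prime field *)

Section PrimeCase.
Variable p : nat.
Hypothesis p_pr : prime p.
Local Notation F := 'F_p.
Implicit Types s t : seq F.

Lemma reach_two_exceptions (x y z : F) k :
    y != x -> z != x -> y != z -> (1 < k)%N -> (k.+2 < p)%N ->
  (k.+2 <= #|reach (nseq k x ++ [:: y; z])|)%N.
Proof.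
move=> yx zx yz k1 kp.
have -> : nseq k x ++ [:: y; z] = [seq u + x | u <- nseq k 0 ++ [:: y - x; z - x]].
  by rewrite map_cat map_nseq add0r /= !subrK.
rewrite reach_translate; apply: reach_two_exceptions0; rewrite ?subr_eq0 //.
by rewrite (inj_eq (addIr _)).
Qed.

Lemma reach_cat_ge s t a b : (a <= #|reach s|)%N -> (b <= #|reach t|)%N ->
  (minn p (a + b).-1 <= #|reach (s ++ t)|)%N.
Proof.
move=> sa tb; apply: leq_trans (reach_cat p_pr s t).
rewrite leq_min geq_minl (leq_trans (geq_minr _ _)) //.
by rewrite -!subn1 leq_sub2r // leq_add.
Qed.

(** In the main case three distinct entries give 4 sums and the others, by induction, at least
    [size s - 3]; Cauchy-Davenport then gives [4 + (size s - 3) - 1]. *)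
Lemma reach_ge_size s :
  (size s < p)%N -> (size s <= 1)%N || ~~ constant s -> (size s <= #|reach s|)%N.
Proof.
have [n] := ubnP (size s); elim: n s => // n IHn s sn sp ok.
have [s1|s1] := leqP (size s) 1; first by rewrite (leq_trans s1) ?card_reach_gt0.
move: ok; rewrite leqNgt s1 /= => ncs.
case: (seq_shape s) => [cs|[x [y [a [b [xy a0 b0 sE]]]]]|[x [y [z [r [u3 sE]]]]]].
- by rewrite cs in ncs.
- have szE := perm_size sE; rewrite size_cat !size_nseq in szE.
  rewrite (reach_perm sE) szE; apply: reach_two_values => //.
  by rewrite -szE ltnW.
case: (three_values_shape u3 sE) => [[x' [y' [z' [r' [u3' sE' ok]]]]]|[c [y' [z' [k [yc zc yz k1 sE']]]]]].
  have szE := perm_size sE'; rewrite /= in szE.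
  have p3 : (3 < p)%N.
    by apply: leq_ltn_trans sp; rewrite szE.
  rewrite (reach_perm sE') szE -[[:: x', y', z' & r']]/([:: x'; y'; z'] ++ r').
  have rr : (size r' <= #|reach r'|)%N by apply: IHn => //; lia.
  apply: leq_trans (reach_cat_ge (reach_distinct3 p_pr p3 u3') rr).
  by move: sp; rewrite szE leq_min => /ltnW ->; exact: leqnn.
have szE := perm_size sE'; rewrite size_cat size_nseq /= addn2 in szE.
by rewrite (reach_perm sE') szE; apply: reach_two_exceptions => //; rewrite -szE.
Qed.

(** Moving the first entry to the end subtracts the total: it goes from position 0 to [p - 1], which
    is -1 modulo [p], and all others drop by one. So the values are stable under a nonzero shift. *)
Lemma reach_full s : size s = p -> \sum_(x <- s) x != 0 -> reach s = setT.
Proof.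
move=> sp s0; apply/eqP/negPn/negP => rT.
have s0' : - \sum_(x <- s) x != 0 by rewrite oppr_eq0.
have [_ /reachP[t ts <-]] := proper_shift p_pr s0' (reach_neq0 s) rT.
case/negP; apply/reachP; exists (rot 1 t); first by rewrite perm_rot.
rewrite -(perm_big _ ts) /=; have := perm_size ts; rewrite sp.
case: t {ts} => [|x t] /= tp; first by rewrite big_nil subr0.
rewrite rot1_cons -cats1 dot_cat /= ?big_cons ?big_nil ?addr0 ?add0r.
have -> : x *+ size t = - x.
  apply/eqP; rewrite -addr_eq0 -mulrSr tp -mulr_natr; apply/eqP.
  by rewrite (pcharf0 (pchar_Fp p_pr)) mulr0.
by ring.
Qed.

Lemma dot_nseq (V : comPzRingType) (x : V) k : dot (nseq k x) = x *+ 'C(k, 2).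
Proof.
by elim: k => //= k ->; rewrite sum_nseq -mulrnDr binS bin1.
Qed.

Theorem prime_seq s :
    odd p -> size s = p ->
  0 \in reach s \/ exists c y z : F,
    [/\ perm_eq s [:: y, z & nseq (p - 2) c], y + z = c + c & y != c].
Proof.
move=> podd sp.
have [s0|s0] := eqVneq (\sum_(x <- s) x) 0; last by left; rewrite reach_full ?inE.
have p0 : p%:R = 0 :> F by rewrite (pcharf0 (pchar_Fp p_pr)).
have p3 : (2 < p)%N by rewrite odd_prime_gt2.
case: (seq_shape s) => [cs|[x [y [a [b [xy a0 b0 sE]]]]]|[x [y [z [r [u3 sE]]]]]].
- left; apply/reachP; exists s => //.
  have /(constantP 0)[x ->] := cs; rewrite sp dot_nseq.
  have /dvdnP[q ->] := @prime_dvd_bin 2 p p_pr p3.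
  by rewrite -mulr_natr natrM p0 !mulr0.
(* Two values cannot occur: [a + b = p] and a zero total give [b (y - x) = 0] with [0 < b < p]. *)
- case/eqP: (xy); move: s0; rewrite (perm_big _ sE) big_cat /= !sum_nseq => s0.
  have := perm_size sE; rewrite size_cat !size_nseq sp => pE.
  have aE : a%:R = - b%:R :> F by apply/eqP; rewrite -addr_eq0 -natrD -pE p0.
  have b0' : b%:R != 0 :> F.
    by rewrite -(dvdn_pcharf (pchar_Fp p_pr)); apply/negP => /dvdn_leq; lia.
  have xE : (x : F) *+ a = - (x *+ b) by rewrite -(mulr_natr (x : F) a) aE mulrN; congr (- _); exact: mulr_natr.
  move: s0; rewrite xE addrC => /eqP; rewrite subr_eq0 => /eqP yxb.
  apply: (mulIf b0'); rewrite (mulr_natr (x : F)) (mulr_natr (y : F)); exact: esym.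
case: (three_values_shape u3 sE) => [[x' [y' [z' [r' [u3' sE' ok]]]]]|[c [y' [z' [k [yc zc yz k1 sE']]]]]].
  have szE := perm_size sE'; rewrite /= sp in szE.
  (* For [p = 3], three entries with zero total satisfy [y' + z' = - x' = 2 x'], which is the
     exceptional shape with [c = x']. *)
  have [r0|r0] := eqVneq r' [::].
    have pE : p = 3 by rewrite szE r0.
    right; exists x', y', z'; have -> : (p - 2 = 1)%N by rewrite pE.
    move: u3'; rewrite /= !inE negb_or andbT => /andP[/andP[xy' _] _].
    split; last by rewrite eq_sym.
      by apply/seq.permP => q; rewrite (seq.permP sE') r0 /=; ring.
    move: s0; rewrite (perm_big _ sE') r0 /= !big_cons big_nil addr0 => s0.
    have x3 : x' + (x' + x') = 0 :> F.
      have <- : x' *+ p = x' + (x' + x') :> F by exact: (congr1 (fun k => (x' : F) *+ k) pE).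
      by rewrite -mulr_natr p0 mulr0.
    by apply: (addrI (x' : F)); rewrite x3.
  have p4 : (3 < p)%N by rewrite szE; case: (r') r0.
  left; rewrite (_ : reach s = setT) ?inE //; apply/eqP.
  rewrite eqEcard subsetT cardsT card_Fp //=.
  rewrite (reach_perm sE') -[[:: x', y', z' & r']]/([:: x'; y'; z'] ++ r').
  have rr : (size r' <= #|reach r'|)%N by apply: reach_ge_size => //; lia.
  apply: leq_trans (reach_cat_ge (reach_distinct3 p_pr p4 u3') rr).
  by rewrite leq_min leqnn [leqLHS]szE; exact: leqnn.
(* Here [k = p - 2], and the zero total becomes [y' + z' = 2 c]. *)
right; exists c, y', z'; have szE := perm_size sE'; rewrite size_cat size_nseq /= sp in szE.
have kE : (p - 2 = k)%N by rewrite szE addnK.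
split=> //; first by rewrite kE (permPl sE') perm_catC.
move: s0; rewrite (perm_big _ sE') big_cat /= !big_cons big_nil sum_nseq addr0.
have -> : c *+ k = - (c + c).
  by apply/eqP; rewrite -addr_eq0 -mulr2n -mulrnDr -szE -mulr_natr p0 mulr0.
by rewrite addrC => /eqP; rewrite subr_eq0 => /eqP.
Qed.

End PrimeCase.


(** * Weightings of finite sets of integers *)

Section Residues.
Variables (m : nat) (m_gt0 : (0 < m)%N).

(** The type ['I_m.-1.+1] is the one behind [Zmod m] and is inhabited for every [m], as [inord]
    requires. *)
Definition residue (x : int) : 'I_m.-1.+1 := inord `|(x %% m)%Z|.

Lemma residueE x : (residue x)%:Z = (x %% m)%Z.
Proof.
have m0 : m%:Z != 0 by rewrite eqz_nat -lt0n.
rewrite /residue inordK ?gez0_abs ?modz_ge0 //.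
by rewrite prednK // -ltz_nat gez0_abs ?modz_ge0 // ltz_pmod.
Qed.

Lemma dvdz_sub_residue x : (m %| x - (residue x)%:Z)%Z.
Proof. by rewrite residueE -eqz_mod_dvd modz_mod. Qed.

Lemma residue_eq x y : (residue x == residue y) = (m %| x - y)%Z.
Proof.
by rewrite -eqz_mod_dvd -!residueE eqz_nat.
Qed.

End Residues.

Section Weights.
Variable I : finType.
Implicit Types (A : {set I}) (f w : I -> int) (m : nat).

(* When #|A| = m this is a bijection from A to Z/mZ, that is, an arrangement. *)
Definition weighting m A w :=
  forall i j, i \in A -> j \in A -> (m %| w i - w j)%Z -> i = j.

(** The target [z] is arbitrary, so that the values of several rows or columns can be made to
    cancel. *)
Definition reaches m A f (z : int) :=
  exists2 w, weighting m A w & (m %| \sum_(i in A) w i * f i - z)%Z.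

(** The second alternative of the theorem up to congruence: with [b = f u - c], [f u] is [c + b] and
    [f v] is [c - b]. *)
Definition exceptional m A f :=
  exists u v c, [/\ [/\ u \in A, v \in A & u != v],
    forall i, i \in A -> i != u -> i != v -> (m %| f i - c)%Z,
    (m %| f u + f v - (c + c))%Z & coprimez (f u - c) m].

Lemma exists_weighting m A : #|A| = m -> exists w, weighting m A w.
Proof.
move=> Am; exists (fun i => (index i (enum A))%:Z) => i j iA jA.
have ltA k : k \in A -> (index k (enum A) < m)%N.
  by move=> kA; rewrite -Am cardE index_mem mem_enum.
rewrite -eqz_mod_dvd !modz_nat eqz_nat !modn_small ?ltA // => /eqP.
by apply: index_inj; rewrite ?mem_enum.
Qed.

Lemma weighting_tperm m A w i j :
  i \in A -> j \in A -> weighting m A w -> weighting m A (w \o tperm i j).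
Proof.
move=> iA jA wA k l kA lA /wA E; apply: (@perm_inj _ (tperm i j)); apply: E.
  by case: tpermP => // ->.
by case: tpermP => // ->.
Qed.

Section Full.
Variables (m : nat) (A : {set I}).
Hypotheses (Am : #|A| = m) (m_gt0 : (0 < m)%N).

Lemma weighting_residues w :
  weighting m A w -> {in A &, injective (residue m \o w)} /\
  [set (residue m \o w) i | i in A] = [set: 'I_m.-1.+1].
Proof.
move=> wA; have gI : {in A &, injective (residue m \o w)}.
  by move=> i j iA jA /eqP; rewrite /= residue_eq // => /(wA _ _ iA jA).
split=> //; apply/eqP; rewrite eqEcard subsetT cardsT card_ord.
by rewrite (card_in_imset gI) Am /= ltn_predL.
Qed.

Lemma weighting_surj w a :
  weighting m A w -> exists2 i, i \in A & (m %| w i - a)%Z.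
Proof.
case/weighting_residues => _ /setP /(_ (residue m a)).
rewrite inE => /imsetP[i iA /esym/eqP]; rewrite /= residue_eq // => ia.
by exists i.
Qed.

(** The weights run through all residues, and [0 + ... + (m - 1)] is a multiple of [m] for odd
    [m]. *)
Lemma weighting_sum w : odd m -> weighting m A w -> (m %| \sum_(i in A) w i)%Z.
Proof.
move=> modd wA; have [gI gT] := weighting_residues wA.
have -> : \sum_(i in A) w i =
    \sum_(i in A) (w i - (residue m (w i))%:Z) + \sum_(i in A) (residue m (w i))%:Z.
  by rewrite -big_split; apply: eq_bigr => i _ /=; rewrite subrK.
apply: rpredD; first by apply: rpred_sum => i _; apply: dvdz_sub_residue.
have -> : \sum_(i in A) (residue m (w i))%:Z = \sum_(k < m.-1.+1) k%:Z.
  rewrite (eq_bigl (fun k => k \in [set (residue m \o w) i | i in A])).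
    by rewrite big_imset.
  by move=> k; rewrite gT inE.
rewrite -(big_mkord xpredT (fun k => k%:Z)) prednK //.
rewrite (eq_bigr (fun k => k%:R)); last by move=> k _; rewrite natz.
by rewrite -natr_sum natz bin2_sum bin2odd // PoszM dvdz_mulr.
Qed.

(** One transposition brings weight [a] to [u]; a second brings [b] to [v] and leaves [u] alone,
    because the element of weight [b] is not [u]. *)
Lemma exists_weighting2 u v a b :
    u \in A -> v \in A -> u != v -> ~~ (m %| a - b)%Z ->
  exists w, [/\ weighting m A w, (m %| w u - a)%Z & (m %| w v - b)%Z].
Proof.
move=> uA vA uv ab; have [w0 w0A] := exists_weighting Am.
have [i iA ia] := weighting_surj a w0A.
have w1A := weighting_tperm uA iA w0A; set w1 := _ \o _ in w1A.
have w1u : (m %| w1 u - a)%Z by rewrite /w1 /= tpermL.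
have [j jA jb] := weighting_surj b w1A.
have ju : j != u.
  apply: contraNneq ab => ju.
  have -> : a - b = (w1 j - b) - (w1 u - a) by rewrite ju; ring.
  exact: rpredB.
exists (w1 \o tperm v j); split; first exact: weighting_tperm.
  by rewrite /= tpermD // eq_sym.
by rewrite /= tpermL.
Qed.

End Full.

Lemma reaches_congr m A f z z' :
  (m %| z - z')%Z -> reaches m A f z -> reaches m A f z'.
Proof.
move=> zz' [w wA wz]; exists w => //.
by rewrite -(subrK z (\sum_(i in A) _)) -addrA rpredD.
Qed.

Lemma reaches_some m A f : #|A| = m -> exists z, reaches m A f z.
Proof.
case/exists_weighting=> w wA; exists (\sum_(i in A) w i * f i), w => //.
by rewrite subrr dvdz0.
Qed.

(** Exchanging the weights of [i] and [j] changes the sum by [(f i - f j) * (w i - w j)]. With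
    weights 1 and 0 this is nonzero modulo [m], so one of the two sums avoids [b]. *)
Lemma reaches_not m A f i j b :
    #|A| = m -> i \in A -> j \in A -> ~~ (m %| f i - f j)%Z ->
  exists2 z, ~~ (m %| z - b)%Z & reaches m A f z.
Proof.
move=> Am iA jA fij.
have m0 : (0 < m)%N by rewrite -Am; apply/card_gt0P; exists i.
have ij : i != j by apply: contraNneq fij => ->; rewrite subrr dvdz0.
have m1 : ~~ (m %| 1 - 0)%Z.
  by apply: contra fij => m1; rewrite -[_ - _]mulr1 -[1]subr0 dvdz_mull.
have [w [wA wi wj]] := exists_weighting2 Am m0 iA jA ij m1.
pose S w := \sum_(k in A) w k * f k.
have [Sb|Sb] := boolP (m %| S w - b)%Z; last first.
  by exists (S w) => //; exists w; rewrite ?subrr ?dvdz0.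
exists (S (w \o tperm i j)); last first.
  by exists (w \o tperm i j); [exact: weighting_tperm | rewrite subrr dvdz0].
have SE g : S g = g i * f i + g j * f j + \sum_(k in A | (k != i) && (k != j)) g k * f k.
  rewrite /S (bigD1 i) //= (bigD1 j) /=; last by rewrite jA eq_sym.
  by rewrite addrA; congr (_ + _); apply: eq_bigl => k; rewrite andbA.
apply: contra fij => Sb'.
have : (m %| (S w - b) - (S (w \o tperm i j) - b))%Z by rewrite rpredB.
have RE : \sum_(k in A | (k != i) && (k != j)) (w \o tperm i j) k * f k =
    \sum_(k in A | (k != i) && (k != j)) w k * f k.
  by apply: eq_bigr => k /andP[_ /andP[ki kj]] /=; rewrite tpermD // eq_sym.
rewrite !SE RE /= tpermL tpermR.
set R := \sum_(_ in _ | _) _.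
rewrite (_ : _ - _ = (f i - f j) * (w i - w j)); last by ring.
move=> D; rewrite (_ : f i - f j = (f i - f j) * (w i - w j)
   - ((f i - f j) * (w i - 1) - (f i - f j) * w j)); last by ring.
rewrite subr0 in wj.
by rewrite !rpredB // dvdz_mull.
Qed.

(** A weighting times a unit modulo [p] is a weighting, so the single nonzero value supplied by
    [reaches_not] yields all of them. *)
Lemma reaches_nonzero p A f i j z :
    prime p -> #|A| = p -> i \in A -> j \in A -> ~~ (p %| f i - f j)%Z ->
  ~~ (p %| z)%Z -> reaches p A f z.
Proof.
move=> p_pr Ap iA jA fij z0.
have [y y0 [w wA wy]] := reaches_not 0 Ap iA jA fij; rewrite subr0 in y0.
have cop x : coprimez p x = ~~ (p %| x)%Z.
  by rewrite coprimezE absz_nat prime_coprime.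
have [k ky] : exists k, (p %| k * y - z)%Z.
  have := y0; rewrite -cop => /coprimezP[[a b] /= ab].
  exists (b * z); rewrite (_ : _ - z = - (a * z) * p).
    by rewrite dvdz_mull.
  by rewrite -[z in _ - z]mul1r -ab; ring.
have k0 : ~~ (p %| k)%Z.
  apply: contra z0 => k0; rewrite (_ : z = k * y - (k * y - z)); last by ring.
  by rewrite rpredB // dvdz_mulr.
exists (fun i => k * w i).
  move=> a b aA bA; rewrite -mulrBr Gauss_dvdzr ?cop //; exact: wA.
rewrite (eq_bigr (fun i => k * (w i * f i))) => [|l _]; last by rewrite mulrA.
rewrite -mulr_sumr; set S := \sum_(_ in _) _ in wy *.
rewrite (_ : _ - z = k * (S - y) + (k * y - z)); last by ring.
by rewrite rpredD // dvdz_mull.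
Qed.

(** Adding [k] to all weights shifts the value by [k] times the sum of [f], which is invertible
    modulo [p]. *)
Lemma reaches_all p A f z :
  prime p -> #|A| = p -> ~~ (p %| \sum_(i in A) f i)%Z -> reaches p A f z.
Proof.
move=> p_pr Ap s0; have [y [w wA wy]] := reaches_some f Ap.
have [k ky] : exists k, (p %| y + k * (\sum_(i in A) f i) - z)%Z.
  have : coprimez p (\sum_(i in A) f i) by rewrite coprimezE absz_nat prime_coprime.
  case/coprimezP => [[a b] /= ab]; exists (b * (z - y)).
  set S := \sum_(_ in _) _ in ab *.
  rewrite (_ : _ - z = - (a * (z - y)) * p); first by rewrite dvdz_mull.
  have -> : y + b * (z - y) * S - z = (b * S) * (z - y) - (z - y) by ring.
  have -> : b * S = 1 - a * p by rewrite -ab; ring.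
  by ring.
exists (fun i => w i + k).
  move=> i j iA jA; rewrite (_ : _ - _ = w i - w j); last by ring.
  exact: wA.
rewrite (eq_bigr (fun i => w i * f i + k * f i)) => [|i _]; last by rewrite mulrDl.
rewrite big_split /= -mulr_sumr; set S := \sum_(i in A) f i in ky *.
set W := \sum_(_ in _) _ in wy *.
by rewrite (_ : _ - z = (W - y) + (y + k * S - z)); [rewrite rpredD | ring].
Qed.

Section TwoExceptions.
Variables (m : nat) (A : {set I}) (f : I -> int) (c : int).
Hypotheses (Am : #|A| = m) (m_odd : odd m).

Lemma reaches_const : (forall i, i \in A -> (m %| f i - c)%Z) -> reaches m A f 0.
Proof.
move=> fc; have [w wA] := exists_weighting Am; exists w => //.
rewrite (eq_bigr (fun i => w i * (f i - c) + w i * c)); last by move=> i _; ring.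
rewrite big_split /= -mulr_suml subr0 rpredD //.
  by apply: rpred_sum => i iA; rewrite dvdz_mull ?fc.
by rewrite dvdz_mulr // weighting_sum // odd_gt0.
Qed.

Variables u v : I.
Hypotheses (uA : u \in A) (vA : v \in A) (uv : u != v).
Hypothesis fc : forall i, i \in A -> i != u -> i != v -> (m %| f i - c)%Z.

(** The weights sum to 0 modulo [m], so [f] may be replaced by [f - c], after which only [u] and [v]
    contribute. *)
Lemma reaches_two a b : ~~ (m %| a - b)%Z ->
  reaches m A f (a * (f u - c) + b * (f v - c)).
Proof.
move=> ab; have [w [wA wu wv]] := exists_weighting2 Am (odd_gt0 m_odd) uA vA uv ab.
exists w => //.
rewrite (eq_bigr (fun i => w i * (f i - c) + w i * c)); last by move=> i _; ring.
rewrite big_split /= -mulr_suml.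
have := weighting_sum Am (odd_gt0 m_odd) m_odd wA; set W := \sum_(i in A) w i => W0.
rewrite (bigD1 u) //= (bigD1 v) /=; last by rewrite vA eq_sym.
set R := \sum_(_ | _) _.
have R0 : (m %| R)%Z.
  by apply: rpred_sum => i /andP[/andP[iA iu] iv]; rewrite dvdz_mull ?fc.
rewrite (_ : _ - _ = (w u - a) * (f u - c) + (w v - b) * (f v - c) + R + W * c).
  by rewrite !rpredD // dvdz_mulr.
by ring.
Qed.

Lemma reaches0_two : ~~ (m %| f u + f v - (c + c))%Z -> reaches m A f 0.
Proof.
(* The weights [c - f v] at [u] and [f u - c] at [v] cancel; they are distinct modulo [m] because
   [f u + f v] is not [2 c]. *)
move=> uvc; have := @reaches_two (- (f v - c)) (f u - c).
rewrite (_ : _ * _ + _ = 0); last by ring.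
apply; rewrite (_ : _ - _ = - (f u + f v - (c + c))); last by ring.
by rewrite dvdzE abszN -dvdzE.
Qed.

End TwoExceptions.

(** Give [v] weight 0 and [u] weight [a * z], where [a] inverts [f u - c] modulo [m]; these weights
    differ because [z] is nonzero. *)
Lemma exceptional_reaches m A f z :
    #|A| = m -> odd m -> exceptional m A f -> ~~ (m %| z)%Z -> reaches m A f z.
Proof.
move=> Am m_odd [u [v [c [[uA vA uv] fc uvc cop]]]] z0.
have /coprimezP[[a b] /= ab] := cop.
have k0 : ~~ (m %| a * z - 0)%Z.
  apply: contra z0; rewrite subr0 => az.
  rewrite (_ : z = (a * z) * (f u - c) + (b * z) * m).
    by apply: rpredD; [apply: dvdz_mulr | apply: dvdz_mull].
  by rewrite -[LHS]mul1r -ab; ring.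
apply: reaches_congr (reaches_two Am m_odd uA vA uv fc k0).
rewrite mul0r addr0 (_ : _ - z = (- (b * z)) * m); first by rewrite dvdz_mull.
by rewrite -[z in _ - z]mul1r -ab; ring.
Qed.

End Weights.


(** * The prime case for weightings *)

Lemma perm_map_lift (T U : eqType) (g : T -> U) (e : seq T) (t : seq U) :
  perm_eq t (map g e) -> exists2 e', perm_eq e' e & map g e' = t.
Proof.
elim: t e => [|y t IHt] e te.
  by exists [::] => //; move: (perm_size te); case: (e).
have /mapP[x xe yx] : y \in map g e by rewrite -(perm_mem te) mem_head.
have ex := perm_to_rem xe.
have /IHt[e' e'r e't] : perm_eq t (map g (rem x e)).
  by rewrite -(perm_cons y) (permPl te) yx -map_cons perm_map.
exists (x :: e'); last by rewrite /= e't yx.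
by rewrite (permPr ex) perm_cons.
Qed.

Section PrimeSet.
Variable I : finType.

Lemma prime_reaches (p : nat) (A : {set I}) (f : I -> int) :
  prime p -> odd p -> #|A| = p -> reaches p A f 0 \/ exceptional p A f.
Proof.
move=> p_pr p_odd Ap; pose g i : 'F_p := (f i)%:~R.
have gE x : (p %| x)%Z = (x%:~R == 0 :> 'F_p) by rewrite (dvdz_pcharf (pchar_Fp p_pr)).
have szp : size (map g (enum A)) = p by rewrite size_map -cardE.
have [/reachP[t ts t0]|[c [y [z [sE yz yc]]]]] := prime_seq p_pr p_odd szp.
  left; have [e eA et] := perm_map_lift ts.
  have ue : uniq e by rewrite (perm_uniq eA) enum_uniq.
  have memA i : (i \in e) = (i \in A) by rewrite (perm_mem eA) mem_enum.
  have sze : size e = p by rewrite (perm_size eA) -cardE.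
  exists (fun i => (index i e)%:Z).
    have lte k : k \in A -> (index k e < p)%N by rewrite -sze index_mem memA.
    move=> i j iA jA; rewrite -eqz_mod_dvd !modz_nat eqz_nat !modn_small ?lte // => /eqP.
    by apply: index_inj; rewrite ?memA.
  rewrite subr0 gE rmorph_sum; apply/eqP; rewrite -[RHS]t0 -et dotE size_map.
  have [i0 _] : exists i, i \in A by apply/card_gt0P; rewrite Ap prime_gt0.
  rewrite -big_enum -(perm_big _ eA) /= (big_nth i0) big_mkord. apply: eq_bigr => k _.
  rewrite index_uniq ?ltn_ord // (nth_map i0) // rmorphM /= mulrC.
  by rewrite -mulr_natr.
right; have sE' : perm_eq [:: y, z & nseq (p - 2) c] (map g (enum A)) by rewrite perm_sym.
have [[|u [|v r]] eA et] := perm_map_lift sE'; rewrite // in eA et.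
case: et => gu gv gr.
have ue : uniq [:: u, v & r] by rewrite (perm_uniq eA) enum_uniq.
have memA i : (i \in [:: u, v & r]) = (i \in A) by rewrite (perm_mem eA) mem_enum.
pose cz : int := (c : nat)%:Z.
have cE : cz%:~R = c :> 'F_p by rewrite -pmulrn natr_Zp.
exists u, v, cz; split.
- rewrite -!memA !inE !eqxx orbT; split=> //.
  by move: ue; rewrite /= inE negb_or => /andP[/andP[]].
- move=> i; rewrite -memA !inE => /or3P[/eqP->|/eqP->|ir iu iv].
  + by rewrite eqxx.
  + by rewrite eqxx.
  rewrite gE rmorphB /= cE subr_eq0.
  have : g i \in map g r by apply: map_f.
  by rewrite gr mem_nseq => /andP[].
- by rewrite gE rmorphB !rmorphD /= cE -/(g u) -/(g v) gu gv yz subrr.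
- rewrite coprimez_sym coprimezE absz_nat prime_coprime //.
  rewrite -[(p %| _)%N]/(p %| f u - cz)%Z gE rmorphB /= cE subr_eq0.
  by rewrite -/(g u) gu.
Qed.

End PrimeSet.

(** * Columns *)

Section Columns.
Variables (I : finType) (p n k : nat) (A : {set I}) (f : I -> int) (col : I -> 'I_k).
Hypothesis kn : (k <= n)%N.
Let C s := [set i in A | col i == s].

Lemma sum_columns (F : I -> int) :
  \sum_(i in A) F i = \sum_s \sum_(i in C s) F i.
Proof.
rewrite (partition_big col xpredT) //=; apply: eq_bigr => s _.
by apply: eq_bigl => i; rewrite inE.
Qed.

(** Refining [col] by [n] times a weighting modulo [p] inside each column gives a weighting modulo
    [p * n]. The number [k] of columns is kept apart from [n] to allow both [n] and [n.-1.+1]. *)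
Lemma columns_reaches (z : 'I_k -> int) :
    (forall s, reaches p (C s) f (z s)) ->
    ((p * n)%N %| \sum_(i in A) (col i)%:Z * f i + n%:Z * \sum_s z s)%Z ->
  reaches (p * n)%N A f 0.
Proof.
move=> Cz Sz; have /fin_all_exists2[w wC wz] := Cz.
pose v i := (col i)%:Z + n%:Z * w (col i) i.
have [n0|n0] := posnP n.
  exists v; last by move: Sz; rewrite subr0 n0 mul0r addr0 /v n0 => Sz;
    rewrite (eq_bigr (fun i => (col i)%:Z * f i)) // => i _; rewrite mul0r addr0.
  by move=> i; move: (col i) => -[c ck]; move: (leq_trans ck kn); rewrite n0.
exists v.
  (* [v] determines [col] modulo n, and then [w] modulo p. *)
  move=> i j iA jA; rewrite /v => D.
  have cij : col i = col j.
    have : (n %| (col i)%:Z - (col j)%:Z)%Z.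
      rewrite (_ : _ - _ = ((col i)%:Z + n%:Z * w (col i) i - ((col j)%:Z + n%:Z * w (col j) j))
        - (w (col i) i - w (col j) j) * n%:Z); last by ring.
      by apply: rpredB; [apply: dvdz_trans D; rewrite PoszM dvdz_mull | apply: dvdz_mull].
    rewrite -eqz_mod_dvd !modz_nat eqz_nat !modn_small ?(leq_trans (ltn_ord _) kn) //.
    by move/eqP/ord_inj.
  apply: (wC (col i)); rewrite ?inE ?iA ?jA ?cij //=.
  move: D; rewrite cij opprD addrACA subrr add0r -mulrBr.
  by rewrite mulrC PoszM dvdz_mul2r // eqz_nat -lt0n.
rewrite subr0 (eq_bigr (fun i => (col i)%:Z * f i + n%:Z * (w (col i) i * f i))); last first.
  by move=> i _; rewrite /v; ring.
rewrite big_split /= -mulr_sumr [X in n%:Z * X]sum_columns.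
set B := \sum_(i in A) _ in Sz *.
have D : (p %| \sum_s \sum_(i in C s) w (col i) i * f i - \sum_s z s)%Z.
  rewrite -sumrB; apply: rpred_sum => s _.
  by rewrite (eq_bigr (fun i => w s i * f i)) ?wz // => i; rewrite inE => /andP[_ /eqP->].
set W := \sum_s \sum_(i in C s) _ in D *; set Z := \sum_s z s in Sz D.
rewrite (_ : B + _ = (B + n%:Z * Z) + (W - Z) * n%:Z); last by ring.
by rewrite rpredD // PoszM dvdz_mul.
Qed.

Hypotheses (p_pr : prime p) (Cp : forall s, #|C s| = p).
Hypothesis col0 : (n %| \sum_(i in A) (col i)%:Z * f i)%Z.

Lemma columns_reaches1 (z : 'I_k -> int) s0 t :
    (forall s, s != s0 -> reaches p (C s) f (z s)) ->
    (forall y, (p %| t - y)%Z -> reaches p (C s0) f y) ->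
    ((p * n)%N %| \sum_(i in A) (col i)%:Z * f i + n%:Z * (t + \sum_(s | s != s0) z s))%Z ->
  reaches (p * n)%N A f 0.
Proof.
move=> Cz Ct D; apply: (@columns_reaches (fun s => if s == s0 then t else z s)).
  by move=> s; have [->|/Cz//] := eqVneq s s0; apply: Ct; rewrite subrr dvdz0.
rewrite (bigD1 s0) //= eqxx.
by rewrite [X in t + X](eq_bigr z) // => s /negPf ->.
Qed.

(** A column with nonzero sum modulo [p] reaches every residue and so absorbs whatever the other
    columns leave. *)
Lemma columns_reaches_sum s0 :
  ~~ (p %| \sum_(i in C s0) f i)%Z -> reaches (p * n)%N A f 0.
Proof.
move=> Cs0; have /fin_all_exists[z Cz] s : exists z, reaches p (C s) f z.
  exact: reaches_some.
have [B BE] := dvdzP col0.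
apply: (@columns_reaches1 z s0 (- (B + \sum_(s | s != s0) z s))) => [s _|y _|].
- exact: Cz.
- exact: reaches_all.
by rewrite BE (_ : _ + _ = 0) ?dvdz0 //; ring.
Qed.

(** Column [s1] reaches every nonzero residue modulo [p], and column [s2] has a value other than the
    one that would require 0 from [s1]. *)
Lemma columns_reaches_two s1 s2 i1 j1 i2 j2 :
    s1 != s2 ->
    [/\ i1 \in C s1, j1 \in C s1 & ~~ (p %| f i1 - f j1)%Z] ->
    [/\ i2 \in C s2, j2 \in C s2 & ~~ (p %| f i2 - f j2)%Z] ->
  reaches (p * n)%N A f 0.
Proof.
move=> s12 [i1C j1C ij1] [i2C j2C ij2].
have /fin_all_exists[z Cz] s : exists z, reaches p (C s) f z.
  exact: reaches_some.
have [B BE] := dvdzP col0.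
pose R := \sum_(s | (s != s1) && (s != s2)) z s.
have [z2 z20 Cz2] := reaches_not (- (B + R)) (Cp s2) i2C j2C ij2.
apply: (@columns_reaches1 (fun s => if s == s2 then z2 else z s) s1 (- (B + R + z2))).
- by move=> s _; have [->|_] := eqVneq s s2.
- move=> y yE; apply: reaches_nonzero i1C j1C ij1 _ => //.
  apply: contra z20 => y0; rewrite (_ : _ - _ = - ((- (B + R + z2) - y) + y)); last by ring.
  by rewrite rpredN rpredD.
rewrite BE (bigD1 s2) /=; last by rewrite eq_sym.
rewrite eqxx [X in z2 + X](eq_bigr z) => [|s /andP[_ /negPf ->] //].
by rewrite -/R (_ : _ + _ = 0) ?dvdz0 //; ring.
Qed.

(** The other columns are constant modulo [p] and reach 0. Column [s0] must supply [- B], where the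
    total is [B * n]; this is nonzero modulo [p] because [p * n] does not divide the total. *)
Lemma columns_reaches_one s0 i j (c : int) :
    [/\ i \in C s0, j \in C s0 & ~~ (p %| f i - f j)%Z] -> odd p ->
    (forall l, l \in A -> col l != s0 -> (p %| f l - c)%Z) ->
    ~~ ((p * n)%N %| \sum_(i in A) (col i)%:Z * f i)%Z ->
  reaches (p * n)%N A f 0.
Proof.
move=> [iC jC ij] p_odd fc B0; have [B BE] := dvdzP col0.
apply: (@columns_reaches1 (fun=> 0) s0 (- B)).
- move=> s ss0; apply: (@reaches_const _ _ _ _ c) => // l.
  by rewrite inE => /andP[lA /eqP ls]; apply: fc; rewrite ?ls.
- move=> y yB; apply: reaches_nonzero iC jC ij _ => //.
  apply: contra B0 => y0; rewrite BE PoszM dvdz_mul //.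
  by rewrite (_ : B = - ((- B - y) + y)); [rewrite rpredN rpredD | ring].
by rewrite BE big1 // addr0 (_ : _ + _ = 0) ?dvdz0 //; ring.
Qed.

End Columns.

(** * Structure of exceptional sets *)

Lemma exceptional_cases (I : finType) (n : nat) (A : {set I}) f :
    #|A| = n -> odd n -> (2 < n)%N -> exceptional n A f ->
  exists c b, [/\ coprimez b n,
    forall i, i \in A -> exists2 e : int, e \in [:: 0; 1; -1] & (n %| f i - (c + e * b))%Z
  & forall e : int, e \in [:: 0; 1; -1] -> exists2 i, i \in A & (n %| f i - (c + e * b))%Z].
Proof.
move=> An n_odd n2 [u [v [c [[uA vA uv] fc uvc cop]]]].
have [x xA /andP[xu xv]] : exists2 x, x \in A & (x != u) && (x != v).
  have /card_gt0P[x] : (0 < #|A :\ u :\ v|)%N.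
    by move: n2; rewrite -An (cardsD1 u) uA (cardsD1 v) in_setD1 eq_sym uv vA /= !ltnS.
  by rewrite !inE => /and3P[xv xu xA]; exists x => //; rewrite xu.
have fu : (n %| f u - (c + 1 * (f u - c)))%Z.
  by rewrite (_ : _ - _ = 0) ?dvdz0 //; ring.
have fv : (n %| f v - (c + -1 * (f u - c)))%Z.
  by rewrite (_ : _ - _ = f u + f v - (c + c)) //; ring.
have fx i : i \in A -> i != u -> i != v -> (n %| f i - (c + 0 * (f u - c)))%Z.
  by rewrite mul0r addr0; apply: fc.
exists c, (f u - c); split=> //.
  move=> i iA; have [->|iu] := eqVneq i u; first by exists 1.
  have [->|iv] := eqVneq i v; first by exists (-1).
  by exists 0; rewrite // fx.
move=> e; rewrite !inE => /or3P[]/eqP->; last 2 first; first by exists u.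
  by exists v.
by exists x => //; apply: fx.
Qed.

Lemma coprimez_congr (n x y : int) :
  (n %| x - y)%Z -> coprimez x n = coprimez y n.
Proof.
case/dvdzP=> q xy; rewrite (_ : x = q * n + y); last by rewrite -xy subrK.
by rewrite /coprimez gcdzC gcdzMDl gcdzC.
Qed.

Section ExceptionalSets.
Variables (I : finType) (n : nat) (A : {set I}) (f : I -> int).
Hypotheses (An : #|A| = n) (n_odd : odd n) (n2 : (2 < n)%N).
Hypothesis Aexc : exceptional n A f.

(** The difference is [b] times 1, -1, 2 or -2, and 2 is a unit modulo the odd [n]. *)
Lemma exceptional_coprime i j : i \in A -> j \in A ->
  ~~ (n %| f i - f j)%Z -> coprimez (f i - f j) n.
Proof.
have [c [b [cop Ab _]]] := exceptional_cases An n_odd n2 Aexc.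
move=> /Ab[e eE fi] /Ab[d dE fj] ij.
have E : (n %| (f i - f j) - (e - d) * b)%Z.
  rewrite (_ : _ - (e - d) * b = (f i - (c + e * b)) - (f j - (c + d * b))).
    exact: rpredB.
  by ring.
rewrite (coprimez_congr E).
have ed : e != d.
  by apply: contra ij => /eqP ed; move: E; rewrite ed subrr mul0r subr0.
rewrite coprimezMl cop andbT.
have c2 : coprimez 2 n by rewrite coprimezE /= coprime2n.
move: ed; move: eE dE; rewrite !inE => /or3P[]/eqP-> /or3P[]/eqP-> // _;
  rewrite coprimezE //= ?coprime1n //; exact: coprime2n.
Qed.

Lemma exceptional_triple : exists x u v, [/\ [/\ x \in A, u \in A & v \in A],
  ~~ (n %| f x - f u)%Z, ~~ (n %| f x - f v)%Z & ~~ (n %| f u - f v)%Z].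
Proof.
have [c [b [cop Ab bA]]] := exceptional_cases An n_odd n2 Aexc.
have [x xA fx] := bA 0 isT; have [u uA fu] := bA 1 isT; have [v vA fv] := bA (-1) isT.
have nb (e : int) : `|e|%N \in [:: 1; 2]%N -> ~~ (n %| e * b)%Z.
  move=> eE; apply: contraL n2 => D.
  have /coprimezP[[s t] /= st] := cop.
  have : (n %| e)%Z.
    rewrite (_ : e = s * (e * b) + (e * t) * n); last by rewrite -[LHS]mulr1 -st; ring.
    by apply: rpredD; apply: dvdz_mull.
  have /andP[e0 e2] : (0 < `|e| <= 2)%N by move: eE; rewrite !inE => /orP[]/eqP->.
  by rewrite dvdzE absz_nat -leqNgt => /(dvdn_leq e0) /leq_trans; apply.
have neq k l (e d : int) : (n %| f k - (c + e * b))%Z -> (n %| f l - (c + d * b))%Z ->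
    `|e - d|%N \in [:: 1; 2]%N -> ~~ (n %| f k - f l)%Z.
  move=> fk fl /nb; apply: contra => kl.
  rewrite (_ : _ * b = (f k - f l) - (f k - (c + e * b)) + (f l - (c + d * b))).
    by rewrite rpredD // rpredB.
  by ring.
exists x, u, v; split=> //.
- exact: neq fx fu isT.
- exact: neq fx fv isT.
- exact: neq fu fv isT.
Qed.

(** Of three pairwise incongruent elements at most one is [i]. *)
Lemma exceptional_avoid i : i \in A -> exists k l,
  [/\ k \in A :\ i, l \in A :\ i & ~~ (n %| f k - f l)%Z].
Proof.
have [x [u [v [[xA uA vA] xu xv uv]]]] := exceptional_triple.
have ne k l : ~~ (n %| f k - f l)%Z -> l != k.
  by apply: contraNneq => ->; rewrite subrr dvdz0.
move=> iA; have [xi|xi] := eqVneq x i.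
  by exists u, v; rewrite !inE -xi !ne // uA vA.
have [ui|ui] := eqVneq u i.
  by exists x, v; rewrite !inE xi xA -ui ne // vA.
by exists x, u; rewrite !inE xi xA ui uA.
Qed.

(** Modulo [n] the sum over [A] is [f u + f v - 2 c], which vanishes, and also [f i + f j - 2 y]. *)
Lemma exceptional_sum y i j : i \in A -> j \in A -> i != j ->
    (forall k, k \in A -> k != i -> k != j -> (n %| f k - y)%Z) ->
  (n %| f i + f j - (y + y))%Z.
Proof.
move=> iA jA ij fy; have [u [v [c [[uA vA uv] fc uvc cop]]]] := Aexc.
have S a b d : a \in A -> b \in A -> a != b ->
    (forall k, k \in A -> k != a -> k != b -> (n %| f k - d)%Z) ->
  (n %| \sum_(k in A) f k - (f a + f b - (d + d)))%Z.
  move=> aA bA ab fd.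
  have -> : \sum_(k in A) f k = \sum_(k in A) (f k - d) + d * n.
    by rewrite sumrB sumr_const An -mulr_natr natz subrK.
  rewrite (bigD1 a) //= (bigD1 b) /=; last by rewrite bA eq_sym.
  set R := \sum_(_ | _) _; rewrite (_ : _ - _ = R + d * n); last by ring.
  rewrite rpredD ?dvdz_mull //.
  by apply: rpred_sum => k /andP[/andP[kA ka] kb]; apply: fd.
have := rpredB (S u v c uA vA uv fc) (S i j y iA jA ij fy).
set T := \sum_(_ in _) _ => D.
rewrite (_ : _ - _ = (T - (f u + f v - (c + c)) - (T - (f i + f j - (y + y))))
  + (f u + f v - (c + c))); last by ring.
by rewrite rpredD.
Qed.

End ExceptionalSets.


Lemma card_class_tperm (I T : finType) (B : {set I}) (row : I -> T) i j t :
    (i \in B) = (j \in B) ->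
  #|[set k in B | row (tperm i j k) == t]| = #|[set k in B | row k == t]|.
Proof.
move=> ij; rewrite -[RHS](card_imset _ (@perm_inj _ (tperm i j))).
apply: eq_card => k; apply/idP/imsetP => [|[l + ->]]; rewrite !inE.
  case/andP=> kB kt; exists (tperm i j k); last by rewrite tpermK.
  by rewrite inE kt andbT; case: tpermP kB => // ->; rewrite ij.
by case/andP=> lB lt; rewrite tpermK lt andbT; case: tpermP lB => // ->; rewrite ij.
Qed.

(** * Rows *)

Section Rows.
Variables (I : finType) (p n : nat) (A : {set I}) (f : I -> int).
Implicit Types (row : I -> 'I_p).
Hypotheses (n_odd : odd n) (n2 : (2 < n)%N).
Let R row t := [set i in A | row i == t].

Definition balanced row := forall t, #|R row t| = n.

Definition row_solvable row := exists2 g : I -> int,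
  forall t, weighting n (R row t) g & (n %| \sum_(i in A) g i * f i)%Z.

Lemma rows_assemble row (z : 'I_p -> int) :
    (forall t, reaches n (R row t) f (z t)) -> (n %| \sum_t z t)%Z ->
  row_solvable row.
Proof.
move=> Rz z0; have /fin_all_exists2[w wR wz] := Rz.
exists (fun i => w (row i) i) => [t i j|].
  rewrite !inE => /andP[iA /eqP it] /andP[jA /eqP jt]; rewrite it jt.
  by apply: wR; rewrite inE ?iA ?jA ?it ?jt /=.
rewrite (sum_columns _ row) -(subrK (\sum_t z t) (\sum_t _)) rpredD //.
rewrite -sumrB; apply: rpred_sum => t _.
by rewrite (eq_bigr (fun i => w t i * f i)) ?wz // => i; rewrite inE => /andP[_ /eqP->].
Qed.

Hypothesis IH : forall B : {set I}, #|B| = n -> reaches n B f 0 \/ exceptional n B f.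

Definition bad_row row t0 := exceptional n (R row t0) f /\
  forall i j, i \in A -> j \in A -> row i != t0 -> row i = row j -> (n %| f i - f j)%Z.

(** Without exceptional rows each row takes the value 0. An exceptional row reaches every nonzero
    residue, so it can be balanced against another row with two values modulo [n], which any row not
    constant modulo [n] has. *)
Lemma rows_solvable_or_bad row :
  balanced row -> row_solvable row \/ exists t0, bad_row row t0.
Proof.
move=> Rn; have /fin_all_exists[b bR] (t : 'I_p) : exists b : bool,
    if b then exceptional n (R row t) f else reaches n (R row t) f 0.
  by have [r|e] := IH (Rn t); [exists false | exists true].
have [/existsP[t0 bt0]|] := boolP [exists t, b t]; last first.
  rewrite negb_exists => /forallP nb; left; apply: (@rows_assemble row (fun=> 0)).
    by move=> t; have := bR t; rewrite (negPf (nb t)).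
  by rewrite big1.
have E0 := bR t0; rewrite bt0 in E0.
have [bad|] := boolP [forall i in A, forall j in A,
    (row i != t0) ==> (row i == row j) ==> (n %| f i - f j)%Z].
  right; exists t0; split=> // i j iA jA it /eqP ij.
  by move/forall_inP/(_ _ iA)/forall_inP/(_ _ jA): bad; rewrite it ij.
rewrite negb_forall_in => /exists_inP[i iA]; rewrite negb_forall_in => /exists_inP[j jA].
rewrite !negb_imply => /and3P[it0 /eqP ij fij]; left.
have /fin_all_exists[z Rz] t : exists z, reaches n (R row t) f z.
  exact: reaches_some.
pose S := \sum_(t | (t != t0) && (t != row i)) z t.
have iR : i \in R row (row i) by rewrite inE iA eqxx.
have jR : j \in R row (row i) by rewrite inE jA ij eqxx.
have [y yS Ry] := reaches_not (- S) (Rn (row i)) iR jR fij.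
rewrite opprK in yS.
have Rt0 : reaches n (R row t0) f (- (y + S)).
  by apply: exceptional_reaches; rewrite // rpredN.
apply: (@rows_assemble row (fun t => if t == t0 then - (y + S)
    else if t == row i then y else z t)).
  by move=> t; have [->//|_] := eqVneq t t0; have [->|_] := eqVneq t (row i).
rewrite (bigD1 t0) //= eqxx (bigD1 (row i)) //= (negPf it0) eqxx.
rewrite (eq_bigr z) => [|t /andP[/negPf -> /negPf -> //]].
by rewrite -/S addNr dvdz0.
Qed.

Lemma balanced_tperm row i j : i \in A -> j \in A ->
  balanced row -> balanced (row \o tperm i j).
Proof. by move=> iA jA Rn t; rewrite -(Rn t) card_class_tperm ?iA. Qed.

(* One of the two rows involved was constant modulo n; after the swap exactly one
   of its elements deviates, so it is neither constant nor exceptional. *)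
Lemma bad_swap_solvable row t0 i j :
    balanced row -> bad_row row t0 -> i \in A -> j \in A -> row i != row j ->
  ~~ (n %| f i - f j)%Z -> row_solvable (row \o tperm i j).
Proof.
move=> Rn [E0 bad].
(* At most one of the two rows is [t0], and the claim is symmetric in [i] and [j]. *)
wlog jt0 : i j / row j != t0.
  move=> wl iA jA rij fij; have [jt0|] := eqVneq (row j) t0; last by move/wl; apply.
  rewrite tpermC; apply: wl => //; first by rewrite -jt0.
    by rewrite eq_sym.
  by rewrite -opprB rpredN.
move=> iA jA rij fij.
set row' := row \o _; have Rn' : balanced row' by exact: balanced_tperm.
have [//|[t1 [E1 bad']]] := rows_solvable_or_bad Rn'.
have row'i : row' i = row j by rewrite /row' /= tpermL.
have mem' k : k \in A -> k != i -> row' k = row j -> (n %| f k - f j)%Z.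
  rewrite /row' /= => kA ki; case: tpermP => [/eqP|_ e|kni knj]; first by rewrite (negPf ki).
    by rewrite e eqxx in rij.
  by move=> kj; apply: bad; rewrite ?kj.
have [t1j|t1j] := eqVneq t1 (row j).
  have iR : i \in R row' t1 by rewrite inE iA row'i t1j eqxx.
  have [k [l []]] := exceptional_avoid (Rn' t1) n_odd n2 E1 iR.
  rewrite !inE t1j => /and3P[ki kA /eqP kj] /and3P[li lA /eqP lj].
  case/negP; rewrite (_ : _ - _ = (f k - f j) - (f l - f j)); last by ring.
  by rewrite rpredB // mem'.
have /card_gt0P[k] : (0 < #|R row' (row j) :\ i|)%N.
  have := Rn' (row j); rewrite (cardsD1 i) inE iA row'i eqxx /= => nE.
  by move: n2; rewrite -nE ltnS => /(leq_trans _); apply.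
rewrite !inE => /and3P[ki kA /eqP kj].
have ik : (n %| f i - f k)%Z by apply: bad'; rewrite ?row'i // eq_sym.
case/negP: fij; rewrite (_ : _ - _ = (f i - f k) + (f k - f j)); last by ring.
by rewrite rpredD // mem'.
Qed.

Hypothesis An : #|A| = (p * n)%N.

(** Rows are consecutive blocks of [n] entries of [e], so the order of [e] decides which elements
    share a row. *)
Lemma rows_of_seq (e : seq I) : (0 < p)%N -> uniq e -> e =i A ->
  exists2 row : I -> 'I_p, balanced row &
    forall i, i \in A -> (row i : nat) = (index i e %/ n)%N.
Proof.
move=> p0 ue eA; have n0 : (0 < n)%N by exact: ltn_trans n2.
have sze : size e = (p * n)%N by rewrite -An -(card_uniqP ue); apply: eq_card.
pose row i : 'I_p := insubd (Ordinal p0) (index i e %/ n)%N.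
have rowE i : i \in A -> (row i : nat) = (index i e %/ n)%N.
  by move=> iA; rewrite /row val_insubd ltn_divLR // -sze index_mem eA iA.
exists row => // t.
have [i0 i0A] : exists i, i \in A by apply/card_gt0P; rewrite An muln_gt0 p0.
have lte (k : 'I_n) : (t * n + k < size e)%N.
  rewrite sze (@leq_trans (t.+1 * n)) ?leq_mul2r ?ltn_ord ?orbT //.
  by rewrite mulSnr ltn_add2l.
have g_inj : injective (fun k : 'I_n => nth i0 e (t * n + k)).
  by move=> k l /eqP; rewrite nth_uniq ?lte // eqn_add2l => /eqP/ord_inj.
rewrite -[RHS]card_ord -(card_imset _ g_inj); apply: eq_card => i.
apply/idP/imsetP => [|[k _ ->]]; rewrite inE.
  case/andP=> iA /eqP rit; exists (Ordinal (ltn_pmod (index i e) n0)) => //=.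
  by rewrite -rit rowE // -divn_eq nth_index ?eA.
have ieA : nth i0 e (t * n + k) \in A by rewrite -eA mem_nth.
rewrite ieA -val_eqE /= rowE // index_uniq ?lte //.
by rewrite divnMDl // divn_small // addn0.
Qed.

End Rows.

(** * Rows that meet a given set unequally *)

Section Separation.
Variables (I : finType) (p n : nat) (A K : {set I}) (f : I -> int).
Hypotheses (n_odd : odd n) (n2 : (2 < n)%N) (p2 : (2 < p)%N).
Hypothesis IH : forall B : {set I}, #|B| = n -> reaches n B f 0 \/ exceptional n B f.
Hypothesis An : #|A| = (p * n)%N.
Hypothesis KA : K \subset A.
Let R (row : I -> 'I_p) t := [set i in A | row i == t].
Let RK (row : I -> 'I_p) t := [set i in K | row i == t].

(** The gap of 2 provides the two columns required by [columns_reaches_two]. *)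
Definition separated row := exists t1 t2, (#|RK row t2| + 2 <= #|RK row t1|)%N.

(** With [K] listed first, the first row has two of its elements and the last has none. If this
    cutting is bad, exchanging two incongruent elements of different rows repairs it; when no such
    exchange keeps the separation, the second alternative remains. *)
Lemma separated_rows : (1 < #|K|)%N -> (#|K|.*2 <= p * n)%N ->
  (exists row, [/\ balanced n A row, row_solvable n A f row & separated row])
  \/ exists i j y, [/\ i != j, K = [set i; j],
       forall k, k \in A -> k \notin K -> (n %| f k - y)%Z,
       (n %| f i + f j - (y + y))%Z & coprimez (f i - y) n].
Proof.
move=> K1 Kpn; have p0 : (0 < p)%N by exact: ltn_trans p2.
have n0 : (0 < n)%N by exact: ltn_trans n2.
pose e := enum K ++ enum (A :\: K).
have ue : uniq e.
  rewrite cat_uniq !enum_uniq andbT /=; apply/hasPn => i.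
  by rewrite !mem_enum inE => /andP[].
have eA : e =i A.
  move=> i; rewrite mem_cat !mem_enum inE; have [iK|//] := boolP (i \in K).
  by rewrite (subsetP KA).
have [row rowb rowE] := rows_of_seq n2 An p0 ue eA.
have indK i : i \in K -> (index i e < #|K|)%N.
  by move=> iK; rewrite /e index_cat mem_enum iK cardE index_mem mem_enum.
pose t1 : 'I_p := Ordinal p0.
pose t3 : 'I_p := Ordinal (ltn_trans (ltnSn 1) p2).
have p1 : (p.-1 < p)%N by rewrite ltn_predL.
pose t2 : 'I_p := Ordinal p1.
have t32 : t3 != t2 by rewrite -val_eqE /= neq_ltn -ltnS prednK ?p2.
have t12 : t1 != t2 by rewrite -val_eqE /= neq_ltn -ltnS prednK ?(ltn_trans _ p2).
have t13 : t1 != t3 by [].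
(* Indices of elements of [K] are below [p * n / 2], which is at most [(p - 1) * n]. *)
have Kt2 i : i \in K -> row i != t2.
  move=> iK; rewrite -val_eqE /= (rowE _ (subsetP KA _ iK)) neq_ltn.
  rewrite ltn_divLR // (leq_trans (indK i iK)) //.
  by rewrite -leq_double (leq_trans Kpn) // -mul2n mulnA leq_mul2r; apply/orP; right; clear - p2; lia.
have RKt2 : #|RK row t2| = 0%N.
  by apply/eqP; rewrite cards_eq0; apply/eqP/setP => i; rewrite !inE;
     apply/negP => /andP[/Kt2/negP].
have RKt1 : (2 <= #|RK row t1|)%N.
  have [i0 i0K] : exists i, i \in K by apply/card_gt0P; exact: ltnW.
  have lt2 k : (k < 2)%N -> nth i0 (enum K) k \in RK row t1.
    move=> k2; have kK : (k < size (enum K))%N by rewrite -cardE (leq_trans k2).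
    have iK : nth i0 (enum K) k \in K by rewrite -mem_enum mem_nth.
    rewrite inE iK -val_eqE /= (rowE _ (subsetP KA _ iK)) /e index_cat mem_enum iK.
    by rewrite index_uniq ?enum_uniq // divn_small // (ltn_trans k2).
  apply/card_gt1P; exists (nth i0 (enum K) 0), (nth i0 (enum K) 1); split; rewrite ?lt2 //.
  by rewrite nth_uniq ?enum_uniq // -cardE // ltnW.
have sep : separated row by exists t1, t2; rewrite RKt2.
have [sol|[t0 bad]] := rows_solvable_or_bad n_odd IH rowb; first by left; exists row.
have swap i j : i \in A -> j \in A -> row i != row j -> ~~ (n %| f i - f j)%Z ->
    separated (row \o tperm i j) ->
    exists row, [/\ balanced n A row, row_solvable n A f row & separated row].
  move=> iA jA rij fij s; exists (row \o tperm i j); split=> //.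
    exact: balanced_tperm.
  exact: (bad_swap_solvable n_odd n2 IH rowb bad).
(* A swap inside [K] or inside its complement leaves all counts [RK] unchanged. *)
have [/exists_inP[i iA /exists_inP[j jA /and3P[rij cij fij]]]|nswap] :=
    boolP [exists i in A, exists j in A,
      [&& row i != row j, (i \in K) == (j \in K) & ~~ (n %| f i - f j)%Z]].
  left; apply: swap rij fij _ => //.
  by exists t1, t2; rewrite /RK !card_class_tperm ?(eqP cij) // -/(RK row t1) RKt2.
have star i j : i \in A -> j \in A -> row i != row j -> (i \in K) = (j \in K) ->
    (n %| f i - f j)%Z.
  move=> iA jA rij cij; move: nswap; rewrite negb_exists_in => /forall_inP/(_ _ iA).
  by rewrite negb_exists_in => /forall_inP/(_ _ jA); rewrite rij cij eqxx /= negbK.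
have [E0 badE] := bad.
(* Among three pairwise incongruent elements of row [t0], two lie on the same side of [K]. *)
have [a [b [aE bE cab fab]]] : exists a b,
    [/\ a \in R row t0, b \in R row t0, (a \in K) = (b \in K) & ~~ (n %| f a - f b)%Z].
  have [x [u [v [[xA uA vA] xu xv uv]]]] := exceptional_triple (rowb t0) n_odd n2 E0.
  case xK : (x \in K); case uK : (u \in K); case vK : (v \in K);
    try (by exists x, u; rewrite xK uK); try (by exists x, v; rewrite xK vK);
    by exists u, v; rewrite uK vK.
have [aA /eqP at0] : a \in A /\ row a == t0 by move: aE; rewrite inE => /andP.
have [bA /eqP bt0] : b \in A /\ row b == t0 by move: bE; rewrite inE => /andP.
(* By [star], an element of that side in another row would be congruent to both [a] and [b]; so the
   whole side lies in row [t0]. *)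
have rowt0 l : l \in A -> (l \in K) = (a \in K) -> row l = t0.
  move=> lA la; apply: contraNeq fab => lt0.
  rewrite (_ : _ - _ = (f a - f l) + (f l - f b)); last by ring.
  by rewrite rpredD // star // ?at0 ?bt0 ?la // eq_sym.
(* The complement of [K] has at least half of [p * n >= 3 * n] elements, too many for one row. *)
have [aK|aK] := boolP (a \in K); last first.
  have : (#|A :\: K| <= n)%N.
    rewrite -(rowb t0) subset_leq_card //; apply/subsetP => l; rewrite !inE.
    by case/andP=> lK lA; rewrite lA rowt0 ?eqxx // (negPf lK) (negPf aK).
  have pn3 : (3 * n <= p * n)%N by rewrite leq_mul2r p2 orbT.
  rewrite cardsD (setIidPr KA) An; clear - Kpn pn3 n0; move: Kpn pn3.
  by move: (p * n)%N #|K| => q k; lia.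
have KE l : l \in K -> row l = t0 by move=> lK; rewrite rowt0 ?(subsetP KA) ?lK.
have t01 : t0 = t1.
  have /card_gt0P[l] : (0 < #|RK row t1|)%N by exact: ltnW.
  by rewrite inE => /andP[/KE -> /eqP].
have bK : b \in K by rewrite -cab.
have ab : a != b by apply: contraNneq fab => ->; rewrite subrr dvdz0.
have mem_row t : exists2 l, l \in A & row l = t.
  have /card_gt0P[l] : (0 < #|R row t|)%N by rewrite rowb.
  by rewrite inE => /andP[lA /eqP]; exists l.
have [l lA lt3] := mem_row t3.
have lK : l \notin K by apply: contraTN isT => /KE; rewrite lt3 t01 => /eqP; rewrite eq_sym (negPf t13).
(* All of [K] lies in row [t1]; sending one element to row [t3] keeps at least two there and none in
   row [t2]. *)
have [K3|K2] := leqP 3 #|K|.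
  have [c cK fcl] : exists2 c, c \in K & ~~ (n %| f c - f l)%Z.
    have [fal|] := boolP (n %| f a - f l)%Z; last by exists a.
    exists b => //; apply: contra fab => fbl.
    by rewrite (_ : _ - _ = (f a - f l) - (f b - f l)); [rewrite rpredB | ring].
  left; apply: (swap c l) => //; [exact: (subsetP KA) | by rewrite KE // lt3 t01 |].
  exists t1, t2.
  have -> : #|RK (row \o tperm c l) t2| = 0%N.
    apply/eqP; rewrite cards_eq0; apply/eqP/setP => k; rewrite !inE /=.
    apply/negP => /andP[kK]; case: tpermP => [_|_|_ _]; rewrite ?lt3 ?(negPf t32) //.
      by rewrite KE // t01 (negPf t12).
    by rewrite KE // t01 (negPf t12).
  rewrite add0n (@leq_trans #|K :\ c|) //.
    by move: K3; rewrite (cardsD1 c) cK.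
  apply/subset_leq_card/subsetP => k; rewrite !inE => /andP[kc kK].
  by rewrite kK /= tpermD 1?eq_sym // ?KE ?t01 //; apply: contraNneq lK => <-.
have KE2 : K = [set a; b].
  apply/eqP; rewrite eq_sym eqEcard cards2 ab -ltnS K2 andbT.
  by apply/subsetP => k; rewrite !inE => /orP[]/eqP->.
right; exists a, b, (f l).
have [l2 l2A l2t] := mem_row t2.
have l2K : l2 \notin K by apply: contraTN isT => /Kt2; rewrite l2t eqxx.
(* Elements sharing row [t3] with [l] are compared with it through [l2] in row [t2]. *)
have nKl k : k \in A -> k \notin K -> (n %| f k - f l)%Z.
  move=> kA kK; have [kt|kt] := eqVneq (row k) t3; last first.
    by apply: star; rewrite ?lt3 // (negPf kK) (negPf lK).
  rewrite (_ : _ - _ = (f k - f l2) + (f l2 - f l)); last by ring.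
  rewrite rpredD // star // ?kt ?l2t ?lt3 ?(negPf kK) ?(negPf l2K) ?(negPf lK) //.
  by rewrite eq_sym.
have abl : (n %| f a + f b - (f l + f l))%Z.
  apply: (exceptional_sum (rowb t0) E0) => // k.
  rewrite inE => /andP[kA _] ka kb; apply: nKl => //.
  by rewrite KE2 !inE negb_or ka.
split=> //.
have /card_gt0P[k] : (0 < #|R row t0 :\ a :\ b|)%N.
  move: n2; rewrite -(rowb t0) (cardsD1 a) aE (cardsD1 b) in_setD1 eq_sym ab bE /=.
  by rewrite !ltnS.
rewrite !inE => /and4P[kb ka kA kt0].
have kl : (n %| f k - f l)%Z by apply: nKl; rewrite // KE2 !inE negb_or ka.
(* If [f a] were congruent to [f k], hence to [f l], then [abl] would make [f b] congruent to them
   too. *)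
have fak : ~~ (n %| f a - f k)%Z.
  apply: contra fab => ak.
  rewrite (_ : _ - _ = (f a - f k) *+ 2 + (f k - f l) *+ 2 - (f a + f b - (f l + f l))).
    by rewrite rpredB // rpredD // rpredMn.
  by ring.
rewrite -(@coprimez_congr n (f a - f k)).
  by apply: (exceptional_coprime (rowb t0) n_odd n2 E0) => //; rewrite inE kA kt0.
by rewrite (_ : _ - _ = - (f k - f l)) ?rpredN //; ring.
Qed.

End Separation.


(** * From weights in the rows to columns *)

Section RowsToColumns.
Variables (I : finType) (p n : nat) (A : {set I}) (f : I -> int) (row : I -> 'I_p).
Hypotheses (n_gt0 : (0 < n)%N) (rowb : balanced n A row).

(** A weighting of an [n]-element row takes every residue modulo [n] once, so each column meets each
    of the [p] rows in exactly one element. *)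
Lemma row_solvable_columns : row_solvable n A f row ->
  exists col : I -> 'I_n.-1.+1,
  [/\ forall s, #|[set i in A | col i == s]| = p,
      (n %| \sum_(i in A) (col i)%:Z * f i)%Z,
      forall i j, i \in A -> j \in A -> row i = row j -> col i = col j -> i = j
    & forall t s, exists i, [/\ i \in A, row i = t & col i = s]].
Proof.
case=> g gR g0; pose col i := residue n (g i).
have col_inj i j : i \in A -> j \in A -> row i = row j -> col i = col j -> i = j.
  move=> iA jA rij /eqP; rewrite residue_eq // => gij.
  by apply: (gR (row i)) gij; rewrite inE ?iA ?jA ?rij eqxx.
have col_surj t s : exists i, [/\ i \in A, row i = t & col i = s].
  have [i] := weighting_surj (rowb t) n_gt0 s (gR t).
  rewrite inE => /andP[iA /eqP it]; rewrite -residue_eq // => /eqP gis.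
  exists i; split=> //; rewrite /col gis; apply: ord_inj; apply/eqP.
  by rewrite -eqz_nat residueE // modz_nat modn_small // -[ltnRHS](prednK n_gt0).
exists col; split=> // [s|].
  have inj : {in [set i in A | col i == s] &, injective row}.
    by move=> i j; rewrite !inE => /andP[iA /eqP si] /andP[jA /eqP sj] rij; apply: col_inj; rewrite ?si.
  rewrite -[RHS]card_ord -(card_in_imset inj); apply: eq_card => t; rewrite !inE.
  apply/imsetP; have [i [iA it si]] := col_surj t s.
  by exists i; rewrite // inE iA si eqxx.
rewrite (eq_bigr (fun i => g i * f i - (g i - (col i)%:Z) * f i)); last by move=> i _; ring.
rewrite sumrB rpredB //; apply: rpred_sum => i _.
by rewrite dvdz_mulr // dvdz_sub_residue.
Qed.

(** At least two columns meet [K] in row [t1] but not in row [t2]. Each holds an element of [K] and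
    one outside, so it is not constant modulo [p]. *)
Lemma separated_reaches (K : {set I}) :
    prime p -> odd p -> K \subset A -> row_solvable n A f row -> separated K row ->
    (forall i j, i \in K -> j \in A -> j \notin K -> ~~ (p %| f i - f j)%Z) ->
  reaches (p * n)%N A f 0.
Proof.
move=> p_pr p_odd KA /row_solvable_columns[col [Cp col0 col_inj col_surj]] [t1 [t2 sep]] Kf.
pose X t := [set col i | i in [set i in K | row i == t]].
have cardX t : #|X t| = #|[set i in K | row i == t]|.
  apply: card_in_imset => i j; rewrite !inE => /andP[iK /eqP it] /andP[jK /eqP jt].
  by apply: col_inj; rewrite ?(subsetP KA) ?it.
have /card_gt1P[s1 [s2 [s1X s2X s12]]] : (1 < #|X t1 :\: X t2|)%N.
  rewrite cardsD; have := subset_leq_card (subsetIr (X t1) (X t2)).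
  by move: sep; rewrite -!cardX; move: #|X t1| #|X t2| #|_ :&: _| => a b c; lia.
have nonconst s : s \in X t1 :\: X t2 -> exists i j,
    [/\ i \in [set i in A | col i == s], j \in [set i in A | col i == s]
      & ~~ (p %| f i - f j)%Z].
  case/setDP=> /imsetP[i]; rewrite inE => /andP[iK it] -> sX.
  have [j [jA jt sj]] := col_surj t2 (col i).
  exists i, j; rewrite !inE jA sj eqxx (subsetP KA) //; split=> //.
  apply: Kf => //; apply: contra sX => jK; apply/imsetP; exists j => //.
  by rewrite inE jK jt eqxx.
have [i1 [j1 ij1]] := nonconst _ s1X; have [i2 [j2 ij2]] := nonconst _ s2X.
by apply: (@columns_reaches_two _ p n _ A f col _ _ _ _ s1 s2 i1 j1 i2 j2); rewrite ?prednK.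
Qed.

End RowsToColumns.

(** * All but two elements congruent modulo [n] and modulo [p] *)

Section TwoSpecialElements.
Variables (I : finType) (p n : nat) (A : {set I}) (f : I -> int).
Hypotheses (p_pr : prime p) (p_odd : odd p) (n_odd : odd n) (n2 : (2 < n)%N).
Hypothesis An : #|A| = (p * n)%N.
Variables (u v : I) (y a : int).
Hypotheses (uA : u \in A) (vA : v \in A) (uv : u != v).
Hypothesis fy : forall k, k \in A -> k != u -> k != v -> (n %| f k - y)%Z.
Hypothesis fa : forall k, k \in A -> k != u -> k != v -> (p %| f k - a)%Z.
Hypothesis fua : ~~ (p %| f u - a)%Z.
Hypothesis fu_cop : coprimez (f u - y) n.

(* The elements u and v have weight 0 modulo n, so the total only sees elements
   congruent to y. *)
Lemma first_column_reaches (col : I -> 'I_n) :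
    (forall s, #|[set i in A | col i == s]| = p) -> col u = 0%N :> nat -> col v = 0%N :> nat ->
    ~~ ((p * n)%N %| \sum_(i in A) (col i)%:Z * f i)%Z ->
  reaches (p * n)%N A f 0.
Proof.
move=> Cp colu colv.
have p2 : (2 < p)%N by rewrite odd_prime_gt2.
have col0 : (n %| \sum_(i in A) (col i)%:Z * f i)%Z.
  rewrite (eq_bigr (fun i => (col i)%:Z * (f i - y) + (col i)%:Z * y)); last by move=> i _; ring.
  rewrite big_split /= -mulr_suml rpredD //.
    apply: rpred_sum => i iA; have [->|iu] := eqVneq i u; first by rewrite colu mul0r rpred0.
    have [->|iv] := eqVneq i v; first by rewrite colv mul0r rpred0.
    by rewrite dvdz_mull // fy.
  (* The weights add up to [p] times [0 + ... + (n - 1)], a multiple of the odd [n]. *)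
  rewrite dvdz_mulr // (sum_columns A col).
  rewrite (eq_bigr (fun s : 'I_n => (s : nat)%:R * p%:Z)); last first.
    move=> s _; rewrite (eq_bigr (fun=> (s : nat)%:Z)); last by move=> i; rewrite inE => /andP[_ /eqP->].
    by rewrite sumr_const Cp natz -[LHS]mulr_natr natz.
  rewrite -mulr_suml -natr_sum -(big_mkord xpredT (fun k => k)) bin2_sum bin2odd //.
  by rewrite natz PoszM dvdz_mulr // dvdz_mulr.
(* Since [p > 2], the column of [u] and [v] has a third element [l]; modulo [p], [f l] is [a] and
   [f u] is not. *)
have /card_gt0P[l] : (0 < #|[set i in A | col i == col u] :\ u :\ v|)%N.
  move: p2; rewrite -(Cp (col u)) (cardsD1 u) inE uA eqxx (cardsD1 v) in_setD1 inE eq_sym uv vA.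
  by rewrite -val_eqE /= colu colv eqxx /= !ltnS.
rewrite !inE => /and4P[lv lu lA lcol].
apply: (@columns_reaches_one _ p n _ A f col _ _ _ _ (col u) u l a) => //.
  rewrite !inE uA lA lcol eqxx; split=> //.
  apply: contra fua => ul; rewrite (_ : _ - _ = (f u - f l) + (f l - a)); last by ring.
  by rewrite rpredD // fa.
move=> k kA kcol; apply: fa => //; apply: contraNneq kcol => -> //.
by rewrite -val_eqE /= colu colv.
Qed.

(** If the elements besides [u] and [v] agree modulo [p * n], either [reaches0_two] applies or [A]
    is exceptional. Otherwise exchanging incongruent [l1] and [l2] between columns 0 and 1 changes
    the total, so one of the two totals is nonzero and [first_column_reaches] applies. *)
Lemma two_special_reaches : (n %| f u + f v - (y + y))%Z ->
  reaches (p * n)%N A f 0 \/ exceptional (p * n)%N A f.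
Proof.
move=> uvy; have p2 : (2 < p)%N by rewrite odd_prime_gt2.
have n0 : (0 < n)%N by exact: ltn_trans n2.
have /card_gt0P[l1] : (0 < #|A :\ u :\ v|)%N.
  have : (2 < #|A|)%N by rewrite An (leq_trans p2) // leq_pmulr.
  by rewrite (cardsD1 u) uA (cardsD1 v) in_setD1 eq_sym uv vA /= !ltnS.
rewrite !inE => /and3P[l1v l1u l1A].
have [/forall_inP fl1|] := boolP [forall k in A, (k != u) ==> (k != v) ==>
    ((p * n)%N %| f k - f l1)%Z].
  have fc k : k \in A -> k != u -> k != v -> ((p * n)%N %| f k - f l1)%Z.
    by move=> kA ku kv; have := fl1 k kA; rewrite ku kv.
  have [D|D] := boolP ((p * n)%N %| f u + f v - (f l1 + f l1))%Z; last first.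
    by left; apply: (reaches0_two An _ uA vA uv fc D); rewrite oddM p_odd.
  right; exists u, v, (f l1); split=> //.
  rewrite PoszM coprimezMr; apply/andP; split.
    rewrite coprimez_sym coprimezE absz_nat prime_coprime //.
    apply: contra fua => ul; rewrite (_ : _ - _ = (f u - f l1) + (f l1 - a)); last by ring.
    by rewrite rpredD // fa.
  rewrite (@coprimez_congr n _ (f u - y)) // (_ : _ - _ = - (f l1 - y)); last by ring.
  by rewrite rpredN fy.
rewrite negb_forall_in => /exists_inP[l2 l2A]; rewrite !negb_imply => /and3P[l2u l2v fl2].
left; have l21 : l2 != l1 by apply: contraNneq fl2 => ->; rewrite subrr dvdz0.
pose B := A :\ u :\ v :\ l1 :\ l2.
(* The first [p] entries are [u], [v], [l1] and [p - 3] others, so [l2], at position [p], opens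
   column 1. *)
pose e := [:: u; v; l1] ++ (take (p - 3) (enum B) ++ l2 :: drop (p - 3) (enum B)).
have pe : perm_eq e [:: u, v, l1, l2 & enum B].
  rewrite /e /= !perm_cons -cat1s perm_catCA /= perm_cons.
  by rewrite cat_take_drop.
have ue : uniq e.
  rewrite (perm_uniq pe) /= enum_uniq andbT !inE !mem_enum !inE !eqxx !andbF !orbF.
  have [ul1 vl1] : u != l1 /\ v != l1 by split; rewrite eq_sym.
  have [ul2 vl2 l12] : [/\ u != l2, v != l2 & l1 != l2] by split; rewrite eq_sym.
  by rewrite !negb_or uv ul1 ul2 vl1 vl2 l12.
have eA : e =i A.
  move=> k; rewrite (perm_mem pe) !inE mem_enum !inE.
  have [->|_] := eqVneq k u; first by rewrite uA.
  have [->|_] := eqVneq k v; first by rewrite vA.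
  have [->|_] := eqVneq k l1; first by rewrite l1A.
  by have [->|_] := eqVneq k l2; first by rewrite l2A.
have An' : #|A| = (n * p)%N by rewrite mulnC.
(* Here [p] and [n] exchange roles: the blocks of [p] entries are the columns. *)
have [col Cp colE] := rows_of_seq p2 An' n0 ue eA.
have small k i : i \in A -> index i e = k -> (k < p)%N -> col i = 0%N :> nat.
  by move=> iA ie kp; rewrite colE // ie divn_small.
have colu : col u = 0%N :> nat by apply: (small 0%N); rewrite //= ?eqxx // ltnW // ltnW.
have colv : col v = 0%N :> nat.
  by apply: (small 1%N); rewrite //= ?(negPf uv) ?eqxx // ltnW.
have coll1 : col l1 = 0%N :> nat.
  by apply: (small 2%N); rewrite //= ![_ == l1]eq_sym (negPf l1u) (negPf l1v) eqxx.
have coll2 : col l2 = 1%N :> nat.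
  have szB : size (take (p - 3) (enum B)) = (p - 3)%N.
    apply: size_takel; rewrite -cardE.
    have : (4 + #|B| = p * n)%N.
      by rewrite -An -(eq_card eA) (card_uniqP ue) (perm_size pe) /= -cardE.
    have : (p * 2 <= p * n)%N by rewrite leq_mul2l ltnW ?orbT.
    by clear - p2; move: (p * n)%N #|B| => q b; lia.
  have l2e : nth l2 e p = l2.
    by rewrite /e nth_cat /= ltnNge p2 /= nth_cat szB ltnn subnn.
  have sze : (p < size e)%N.
    by rewrite /e !size_cat /= szB; clear - p2; move: (size _) => q; lia.
  by rewrite colE // -{1}l2e index_uniq // divnn prime_gt0.
pose S (c : I -> 'I_n) := \sum_(i in A) (c i)%:Z * f i.
have [D|D] := boolP ((p * n)%N %| S col)%Z; last exact: first_column_reaches D.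
pose col' := col \o tperm l1 l2.
apply: (@first_column_reaches col').
- by move=> s; rewrite -(Cp s) /col' card_class_tperm // l1A l2A.
- by rewrite /col' /= tpermD.
- by rewrite /col' /= tpermD.
apply: contra fl2; rewrite -/(S col') => D'.
have SE (c : I -> 'I_n) : S c = (c l1)%:Z * f l1 + (c l2)%:Z * f l2
    + \sum_(k in A | (k != l1) && (k != l2)) (c k)%:Z * f k.
  rewrite /S (bigD1 l1) //= (bigD1 l2) /=; last by rewrite l2A.
  by rewrite addrA; congr (_ + _); apply: eq_bigl => k; rewrite andbA.
rewrite (_ : f l2 - f l1 = S col - S col'); first by rewrite rpredB.
rewrite !SE; have -> : \sum_(k in A | (k != l1) && (k != l2)) (col' k)%:Z * f k =
    \sum_(k in A | (k != l1) && (k != l2)) (col k)%:Z * f k.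
  by apply: eq_bigr => k /andP[_ /andP[k1 k2]]; rewrite /col' /= tpermD // eq_sym.
by rewrite /col' /= tpermL tpermR coll1 coll2; ring.
Qed.

End TwoSpecialElements.


(** * The induction step *)

Section CompositeStep.
Variables (I : finType) (p n : nat) (A : {set I}).
Hypotheses (p_pr : prime p) (p_odd : odd p) (n_odd : odd n) (n2 : (2 < n)%N).
Hypothesis An : #|A| = (p * n)%N.
Hypothesis IH : forall (f : I -> int) (B : {set I}), #|B| = n ->
  reaches n B f 0 \/ exceptional n B f.

(** A bad cutting is repaired by exchanging an element [l] of another row with an element of the
    exceptional row incongruent to it. *)
Lemma exists_row_solvable (f : I -> int) :
  exists2 row : I -> 'I_p, balanced n A row & row_solvable n A f row.
Proof.
have eA : enum A =i A by move=> i; rewrite mem_enum.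
have [row rowb _] := rows_of_seq n2 An (prime_gt0 p_pr) (enum_uniq A) eA.
have [sol|[t0 bad]] := rows_solvable_or_bad n_odd (IH f) rowb; first by exists row.
have [x [u [v [[xE uE _] xu _ _]]]] := exceptional_triple (rowb t0) n_odd n2 bad.1.
have [t tt0] : exists t : 'I_p, t != t0.
  have /card_gt0P[t] : (0 < #|[set~ t0]|)%N.
    by rewrite cardsC1 card_ord -subn1 subn_gt0 prime_gt1.
  by rewrite !inE; exists t.
have /card_gt0P[l] : (0 < #|[set i in A | row i == t]|)%N by rewrite rowb; apply: ltn_trans n2.
rewrite inE => /andP[lA /eqP lt].
have [k [kA kt0 kl]] : exists k, [/\ k \in A, row k = t0 & ~~ (n %| f k - f l)%Z].
  move: xE uE; rewrite !inE => /andP[xA /eqP xt] /andP[uA /eqP ut].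
  have [xl|] := boolP (n %| f x - f l)%Z; last by exists x.
  exists u; split=> //; apply: contra xu => ul.
  by rewrite (_ : _ - _ = (f x - f l) - (f u - f l)); [rewrite rpredB | ring].
exists (row \o tperm k l); first exact: balanced_tperm.
by apply: (bad_swap_solvable n_odd n2 (IH f) rowb bad) kl => //; rewrite kt0 lt eq_sym.
Qed.

Definition congruence_class (f : I -> int) (a : I) : {set I} :=
  [set i in A | (p %| f i - f a)%Z].

Lemma large_class (f : I -> int) :
  exists2 a, a \in A & (n <= #|congruence_class f a|)%N.
Proof.
have p0 := prime_gt0 p_pr; have n0 : (0 < n)%N by exact: ltn_trans n2.
have [/exists_inP[a aA na]|] := boolP [exists a in A, n <= #|congruence_class f a|]%N.
  by exists a.
rewrite negb_exists_in => /forall_inP small.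
have : (#|A| <= p * n.-1)%N; last first.
  by rewrite An leq_mul2l leqNgt ltn_predL n0 orbF eqn0Ngt p0.
pose r i := residue p (f i).
have classE s : #|[set i in A | r i == s]| = (\sum_(i in A | r i == s) 1)%N.
  by rewrite sum1dep_card; apply: eq_card => i; rewrite !inE.
have -> : (p * n.-1 = \sum_(s : 'I_p.-1.+1) n.-1)%N.
  by rewrite sum_nat_const card_ord prednK.
rewrite -sum1_card (partition_big r xpredT) //=; apply: leq_sum => s _.
rewrite -classE; have [->|/set0Pn[a]] := eqVneq [set i in A | r i == s] set0.
  by rewrite cards0.
rewrite inE => /andP[aA /eqP ra]; rewrite -ltnS (prednK n0) ltnNge.
apply: contra (small a aA) => /leq_trans; apply; apply/subset_leq_card/subsetP => i.
by rewrite !inE -ra => /andP[->]; rewrite residue_eq.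
Qed.

Lemma composite_step (f : I -> int) :
  reaches (p * n)%N A f 0 \/ exceptional (p * n)%N A f.
Proof.
have p0 := prime_gt0 p_pr; have p2 : (2 < p)%N by rewrite odd_prime_gt2.
have n0 : (0 < n)%N by exact: ltn_trans n2.
have m_odd : odd (p * n) by rewrite oddM p_odd.
have [a aA na] := large_class f; set M := congruence_class f a in na.
have MA : M \subset A by apply/subsetP => i; rewrite inE => /andP[].
have fM i j : i \in M -> j \in M -> (p %| f i - f j)%Z.
  rewrite !inE => /andP[_ ia] /andP[_ ja].
  by rewrite (_ : _ - _ = (f i - f a) - (f j - f a)); [rewrite rpredB | ring].
have aM : a \in M by rewrite inE aA subrr dvdz0.
have fnM i j : i \in M -> j \in A -> j \notin M -> ~~ (p %| f i - f j)%Z.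
  move=> iM jA; apply: contra => ij; rewrite inE jA /=.
  rewrite (_ : _ - _ = (f i - f a) - (f i - f j)); last by ring.
  by rewrite rpredB // fM.
(* When all values agree modulo [p], write [f i = t i * p + f a] and take weights modulo [n] that
   kill the sum for [t], completed by the row numbers. The term in [f a] vanishes with the sum of
   the weights. *)
have [AM|AM] := eqVneq (A :\: M) set0.
  left; have allM i : i \in A -> i \in M.
    by move=> iA; apply: contraT => iM; have := in_set0 i; rewrite -AM inE iM iA.
  pose t i := ((f i - f a) %/ p)%Z.
  have fE i : i \in A -> f i = t i * p + f a.
    by move=> iA; rewrite /t divzK ?subrK // fM // allM.
  have [row rowb sol] := exists_row_solvable t.
  have [col [_ col0 col_inj _]] := row_solvable_columns n0 rowb sol.
  have wA : weighting (p * n)%N A (fun i => (col i)%:Z + (row i)%:Z * n%:Z).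
    move=> i j iA jA D.
    have cij : col i = col j.
      have : (n %| (col i)%:Z - (col j)%:Z)%Z.
        rewrite (_ : _ - _ = ((col i)%:Z + (row i)%:Z * n%:Z - ((col j)%:Z + (row j)%:Z * n%:Z))
          - ((row i)%:Z - (row j)%:Z) * n%:Z); last by ring.
        by apply: rpredB; [apply: dvdz_trans D; rewrite PoszM dvdz_mull | apply: dvdz_mull].
      have lt k : (col k < n)%N by rewrite -[ltnRHS](prednK n0).
      by rewrite -eqz_mod_dvd !modz_nat eqz_nat !modn_small // => /eqP/ord_inj.
    apply: col_inj => //; move: D; rewrite cij opprD addrACA subrr add0r -mulrBl.
    rewrite PoszM dvdz_mul2r ?eqz_nat -?lt0n //.
    by rewrite -eqz_mod_dvd !modz_nat eqz_nat !modn_small // => /eqP/ord_inj.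
  exists (fun i => (col i)%:Z + (row i)%:Z * n%:Z) => //; rewrite subr0.
  rewrite (eq_bigr (fun i => ((col i)%:Z + (row i)%:Z * n%:Z) * f a +
      (p%:Z * ((col i)%:Z * t i) + (p%:Z * n%:Z) * ((row i)%:Z * t i)))); last first.
    by move=> i iA; rewrite fE //; ring.
  rewrite !big_split /= -mulr_suml -!mulr_sumr rpredD //.
    by rewrite dvdz_mulr // weighting_sum // muln_gt0 p0.
  by apply: rpredD; [rewrite PoszM dvdz_mul | rewrite -PoszM dvdz_mulr].
(* The column of a single outsider [i] has sum congruent to [f i - f a], nonzero modulo [p]. *)
have [AM1|AM1] := leqP #|A :\: M| 1.
  have /cards1P[i iE] : #|A :\: M| == 1%N by rewrite eqn_leq AM1 card_gt0.
  have [iA iM] : i \in A /\ i \notin M by apply/andP; rewrite andbC -in_setD iE set11.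
  left; have [row rowb sol] := exists_row_solvable f.
  have [col [Cp col0 _ _]] := row_solvable_columns n0 rowb sol.
  apply: (@columns_reaches_sum _ p n _ A f col _ _ _ _ (col i)) => //; first by rewrite prednK.
  apply: contra (fnM a i aM iA iM).
  rewrite (eq_bigr (fun k => (f k - f a) + f a)); last by move=> k _; rewrite subrK.
  rewrite big_split /= sumr_const Cp (bigD1 i) /=; last by rewrite inE iA eqxx.
  set S := \sum_(_ | _) _ => D.
  have S0 : (p %| S)%Z.
    apply: rpred_sum => k /andP[]; rewrite inE => /andP[kA _] ki; apply: fM => //.
    by apply: contraNT ki => kM; rewrite -in_set1 -iE inE kM.
  rewrite (_ : _ - _ = S + f a * p%:Z - (f i - f a + S + f a *+ p)).
    by rewrite rpredB // rpredD // dvdz_mull.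
  by rewrite -(mulr_natr (f a)) natz; ring.
pose good (K : {set I}) := forall i j, i \in K -> j \in A -> j \notin K -> ~~ (p %| f i - f j)%Z.
have sepK (K : {set I}) : K \subset A -> good K -> (1 < #|K|)%N -> (#|K|.*2 <= p * n)%N ->
   reaches (p * n)%N A f 0
  \/ exists i j y, [/\ i != j, K = [set i; j],
       forall k, k \in A -> k \notin K -> (n %| f k - y)%Z,
       (n %| f i + f j - (y + y))%Z & coprimez (f i - y) n].
  move=> KA Kf K1 K2; have [[row [rowb sol sep]]|?] := separated_rows n_odd n2 p2 (IH f) An KA K1 K2.
    by left; apply: separated_reaches sol sep Kf.
  by right.
have cardM : (#|M| + #|A :\: M| = p * n)%N by rewrite -An -(cardsID M A) (setIidPr MA).
(* The smaller of [M] and its complement serves as [K]. For [M], the two-element alternative is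
   excluded by [#|M| >= n > 2]. *)
have [M2|M2] := leqP #|M|.*2 (p * n)%N.
  have M1 : (1 < #|M|)%N by rewrite (leq_trans _ na) // ltnW.
  have [|[i [j [y [ij ME _ _ _]]]]] := sepK M MA fnM M1 M2; first by left.
  by move: na; rewrite ME cards2 ij; case: (n) n2 => [|[|[]]].
have gA : good (A :\: M).
  move=> i j /setDP[iA iM] jA; rewrite inE jA andbT negbK => jM.
  by apply: contra (fnM j i jM iA iM) => D; rewrite -opprB rpredN.
have AM2 : (#|A :\: M|.*2 <= p * n)%N.
  by clear - M2 cardM; move: (p * n)%N #|M| #|A :\: M| M2 cardM => q b c; lia.
have [|[i [j [y [ij AME fy ijy cop]]]]] := sepK _ (subsetDl A M) gA AM1 AM2; first by left.
have mem k : k \in A :\: M -> k \in A /\ k \notin M by case/setDP.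
have [[iA iM] [jA jM]] : (i \in A /\ i \notin M) /\ (j \in A /\ j \notin M).
  by split; apply: mem; rewrite AME !inE eqxx ?orbT.
have notAM k : k != i -> k != j -> k \notin A :\: M by rewrite AME !inE negb_or => -> ->.
apply: (two_special_reaches p_pr p_odd n_odd n2 An (y := y) (a := f a) iA jA ij) => //.
- by move=> k kA ki kj; apply: fy => //; apply: notAM.
- move=> k kA ki kj; apply: fM => //.
  by have := notAM k ki kj; rewrite inE kA andbT negbK.
- by apply: contra (fnM a i aM iA iM) => D; rewrite -opprB rpredN.
Qed.

End CompositeStep.

(** Strong induction on [m], splitting off its least prime divisor; the cofactor is odd, so it is 1
    or at least 3. *)
Theorem weighted_zero_sum (I : finType) (m : nat) (A : {set I}) (f : I -> int) :
  odd m -> #|A| = m -> reaches m A f 0 \/ exceptional m A f.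
Proof.
have [k] := ubnP m; elim: k m A f => // k IHk m A f mk m_odd Am.
have [m1|m1] := leqP m 1.
  left; have [w wA] := exists_weighting Am; exists w => //.
  by rewrite (_ : m = 1%N) ?dvd1z //; case: (m) m1 m_odd => [|[]].
have p_pr := pdiv_prime m1; set p := pdiv m in p_pr.
have [n mE] := dvdnP (pdiv_dvd m); rewrite -/p mulnC in mE.
have [p_odd n_odd] : odd p /\ odd n by move: m_odd; rewrite mE oddM => /andP.
have [n1|n1] := leqP n 1.
  have mp : m = p by rewrite mE; case: (n) n1 n_odd => [|[|]] //; rewrite muln1.
  by rewrite mp; apply: prime_reaches => //; rewrite -mp.
have n2 : (2 < n)%N by case: (n) n1 n_odd => [|[|[]]].
rewrite mE; apply: composite_step => //; first by rewrite -mE.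
move=> g B Bn; apply: IHk => //; rewrite -ltnS (leq_trans _ mk) // ltnS mE.
by rewrite ltn_Pmull // ?prime_gt1 // ltnW.
Qed.

(** * Return to the cyclic group *)

Section ResidueMorphism.
Variable m : nat.
Local Notation res := (@residue m.+1).

Lemma residueD x y : res (x + y) = res x + res y.
Proof.
apply: ord_inj; apply/eqP; rewrite -eqz_nat residueE // -modz_nat PoszD !residueE //.
by rewrite modzDm.
Qed.

Lemma residue0 : res 0 = 0.
Proof. by apply: ord_inj; apply/eqP; rewrite -eqz_nat residueE // mod0z. Qed.

Lemma residueB x y : res (x - y) = res x - res y.
Proof. by apply/eqP; rewrite -subr_eq opprK -residueD subrK. Qed.

Lemma residue_mulrn x k : res (x *+ k) = res x *+ k.
Proof. by elim: k => [|k IHk]; rewrite ?mulr0n ?residue0 // !mulrS residueD IHk. Qed.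

Lemma residue_ord (i : 'I_m.+1) : res (i : nat)%:Z = i.
Proof.
by apply: ord_inj; apply/eqP; rewrite -eqz_nat residueE // modz_nat modn_small.
Qed.

End ResidueMorphism.

Theorem theorem1p3 (m : nat) (m_odd : odd m) (a : 'I_m -> Zmod m) :
  exists s : {perm 'I_m},
    \sum_(i < m) a (s i) *+ i.+1 = 0
    \/ exists c b : Zmod m,
         [/\ coprime b m,
             forall i : 'I_m, (i.+1 <= m - 2)%N -> a (s i) = c,
             forall i : 'I_m, i.+1 = (m - 1)%N -> a (s i) = c + b
           & forall i : 'I_m, i.+1 = m -> a (s i) = c - b].
Proof.
case: m m_odd a => // m m_odd a.
pose f (i : 'I_m.+1) := (a i : nat)%:Z.
have aE i : a i = residue m.+1 (f i) by rewrite /f residue_ord.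
have eq_residue x y : (m.+1 %| x - y)%Z -> residue m.+1 x = residue m.+1 y.
  by move=> xy; apply/eqP; have := residue_eq (ltn0Sn m) x y; rewrite xy => ->.
have cardT : #|[set: 'I_m.+1]| = m.+1 by rewrite cardsT card_ord.
have [[w wT]|[u [v [c [[_ _ uv] fc uvc cop]]]]] := weighted_zero_sum f m_odd cardT.
  (* Indices start at 0 but multipliers at 1, hence the shift: [(g i).+1] is [w i] modulo [m.+1]. *)
  rewrite subr0 => w0; pose g i : 'I_m.+1 := residue m.+1 (w i - 1).
  have g_inj : injective g.
    move=> i j gij; have D : (m.+1 %| w i - 1 - (w j - 1))%Z.
      by rewrite -residue_eq //; apply/eqP.
    by apply: wT; rewrite ?inE // (_ : _ - _ = w i - 1 - (w j - 1)) //; ring.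
  (* [g] sends elements to positions, whereas the permutation sought sends positions to elements. *)
  exists (perm g_inj)^-1%g; left.
  rewrite (reindex_inj (@perm_inj _ (perm g_inj))) /=.
  rewrite (eq_bigr (fun i => residue m.+1 (f i *+ (g i).+1))); last first.
    by move=> i _; rewrite permK permE aE residue_mulrn.
  rewrite -(big_morph _ (@residueD m) (@residue0 m)) -(residue0 m).
  apply: eq_residue; rewrite subr0.
  rewrite (_ : \sum_i _ = \sum_(i in [set: 'I_m.+1]) w i * f i -
     \sum_i (w i - 1 - (g i : nat)%:Z) * f i).
    rewrite rpredB //; apply: rpred_sum => i _.
    by rewrite dvdz_mulr // dvdz_sub_residue.
  rewrite [X in X - _](eq_bigl xpredT); last by move=> i; rewrite inE.
  rewrite -sumrB; apply: eq_bigr => i _.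
  by rewrite -mulr_natr mulrSr natz; ring.
have m2 : (1 < m.+1)%N.
  by rewrite -cardT; apply/card_gt1P; exists u, v; rewrite !inE.
have lt1 : (m - 1 < m.+1)%N by rewrite ltnS leq_subr.
pose i1 : 'I_m.+1 := Ordinal lt1; pose i2 : 'I_m.+1 := ord_max.
have i12 : i1 != i2 by rewrite -val_eqE /= neq_ltn subn1 ltn_predL -ltnS m2.
(* The first transposition sends [i2] to [x]; the second moves it on to [v] and fixes [u]. *)
pose x := tperm i1 u i2.
have xu : x != u by rewrite -[u in X in _ != X](tpermL i1 u) (inj_eq perm_inj) eq_sym.
pose s := (tperm i1 u * tperm x v)%g.
have s1 : s i1 = u by rewrite permM tpermL tpermD // eq_sym.
have s2 : s i2 = v by rewrite permM tpermL.
exists s; right; exists (residue m.+1 c), (residue m.+1 (f u - c)); split.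
- rewrite -[coprime _ _]/(coprimez (residue m.+1 (f u - c) : nat)%:Z m.+1).
  by rewrite (coprimez_congr (y := f u - c)) // residueE // -eqz_mod_dvd modz_mod.
- move=> i im; rewrite aE; apply: eq_residue; apply: fc; rewrite ?inE //.
    rewrite -s1 (inj_eq perm_inj) -val_eqE /=; clear - im m2; lia.
  rewrite -s2 (inj_eq perm_inj) -val_eqE /=; clear - im m2; lia.
- move=> i im; have -> : i = i1 by apply: ord_inj => /=; clear - im m2; lia.
  by rewrite s1 aE -residueD addrC subrK.
move=> i [im]; have -> : i = i2 by apply: ord_inj.
rewrite s2 aE -residueB; apply: eq_residue.
by rewrite (_ : _ - _ = f u + f v - (c + c)) //; ring.
Qed.
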